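(* Let $K$ be a perfect field of characteristic $p \geq 3$, and let $\lambda_1,\lambda_2,\mu \in K$ be different from $0$ and $1$ and such that $1,\lambda_1,\mu,\mu\lambda_2$ are pairwise distinct. Let $C$ be the Howe curve of genus $3$ associated with the two elliptic curves $$E_1: y^2 = x(x-1)(x-\lambda_1), \qquad E_2: y^2 = x(x-\mu)(x-\mu\lambda_2),$$ put $$\lambda_3 = \frac{(\mu\lambda_2-1)(\mu-\lambda_1)}{(\mu\lambda_2-\lambda_1)(\mu-1)}$$ and $$D = (\lambda_1\lambda_2-\lambda_2\lambda_3-\lambda_3\lambda_1+1)^2 - 4\lambda_1\lambda_2(1-\lambda_3)^2.$$ Then $C$ is hyperelliptic if and only if $D = 0$.
   Context: Let $f_i : E_i \to \mathbb{P}^1$ ($i=1,2$) be the usual double covers $(x,y)\mapsto x$; $f_1$ is ramified over $S_1=\{0,1,\lambda_1,\infty\}$ and $f_2$ is ramified over $S_2=\{0,\mu,\mu\lambda_2,\infty\}$. The Howe curve $C$ associated with $E_1,E_2$ is the desingularization of the fiber product $E_1\times_{\mathbb{P}^1}E_2$ (formed using $f_1,f_2$). When $1,\lambda_1,\mu,\mu\lambda_2$ are pairwise distinct one has $|S_1\cap S_2|=2$, and $C$ is irreducible of genus $3$. ''Hyperelliptic'' is understood over an algebraic closure of $K$. The element $\lambda_3$ is a Legendre parameter of the third quotient curve $E_3: y^2=(x-1)(x-\lambda_1)(x-\mu)(x-\mu\lambda_2)$ of $C$. *)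

(* Defs.v *)
From HB Require Import structures.
From mathcomp Require Import all_boot all_order all_algebra all_field.

Set Implicit Arguments.
Unset Strict Implicit.
Unset Printing Implicit Defensive.

Import GRing.Theory.
Local Open Scope ring_scope.

Definition perfect_field (K : fieldType) : Prop :=
  forall q : {poly K}, irreducible_poly q -> separable_poly q.

Definition algebraic_closure (K : fieldType) (L : closedFieldType)
    (iota : {rmorphism K -> L}) : Prop :=
  forall z : L, algebraicOver iota z.

(* A smooth projective irreducible curve C over an algebraically closed field k
   is represented by its function field F, with structural embedding
   c : k -> F.  Under the usual dictionary:
   - the desingularization of an irreducible, possibly singular, curve is the
     smooth projective curve with the same function field;
   - closed points of C are the proper valuation rings of F containing k;
   - a nonconstant morphism C -> P^1 is a transcendental t : F, and its degree
     is [F : k(t)]. *)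
Section Curve.

Variables (k F : fieldType) (c : {rmorphism k -> F}).

(* Division in F is total (z / 0 = 0), so the last clause gives no trouble
   at b = 0. *)
Definition subfield_closed (P : F -> Prop) : Prop :=
  [/\ P 1,
      forall a b, P a -> P b -> P (a - b)
    & forall a b, P a -> P b -> P (a / b)].

(* z lies in k(S), the intersection of the subfields containing k and S. *)
Definition in_adjoin (S : F -> Prop) (z : F) : Prop :=
  forall P : F -> Prop, subfield_closed P ->
    (forall a, P (c a)) -> (forall s, S s -> P s) -> P z.

(* [F : E] = n, for a subfield E of F: F has an E-basis with n elements. *)
Definition degree_over (E : F -> Prop) (n : nat) : Prop :=
  exists e : 'I_n -> F, forall z : F,
    exists! a : {ffun 'I_n -> F},
      (forall i, E (a i)) /\ z = \sum_(i < n) a i * e i.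

Definition map_to_P1_of_degree (n : nat) (t : F) : Prop :=
  ~ algebraicOver c t /\ degree_over (in_adjoin (eq t)) n.

(* The double covers y^2 = f(x) and y^2 = g(x) of P^1 have function fields
   k(x, y1) and k(x, y2); a component of their fiber product over P^1 has as
   function field the compositum k(x, y1, y2).  When the fiber product is
   irreducible, this determines F uniquely up to isomorphism over k. *)
Definition Howe_function_field (f g : {poly k}) : Prop :=
  exists x y1 y2 : F,
    [/\ ~ algebraicOver c x,
        y1 ^+ 2 = (map_poly c f).[x],
        y2 ^+ 2 = (map_poly c g).[x]
      & forall z, in_adjoin (fun s => [\/ s = x, s = y1 | s = y2]) z].

Definition closed_point (O : F -> Prop) : Prop :=
  [/\ forall a, O (c a),
      forall a b, O a -> O b -> O (a - b),
      forall a b, O a -> O b -> O (a * b),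
      forall z, z != 0 -> O z \/ O z^-1
    & exists z, ~ O z].

Definition derivation (d : F -> F) : Prop :=
  [/\ forall a b, d (a + b) = d a + d b,
      forall a b, d (a * b) = a * d b + b * d a
    & forall a, d (c a) = 0].

(* Omega_{F/k} is finite-dimensional over F and Der_k(F) is its dual, so the
   differential sum_j a_j db_j is identified with the function
   d |-> sum_j a_j d(b_j) on derivations.  It is regular at the point with
   local ring O when it lies in O.dO. *)
Definition regular_at (O : F -> Prop) (w : (F -> F) -> F) : Prop :=
  exists s : seq (F * F),
    (forall ab, ab \in s -> O ab.1 /\ O ab.2) /\
    (forall d, derivation d -> w d = \sum_(ab <- s) ab.1 * d ab.2).

Definition regular_differential (w : (F -> F) -> F) : Prop :=
  forall O, closed_point O -> regular_at O w.

(* The genus is dim_k H^0(C, Omega^1); it is at least n when there are n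
   regular differentials that are linearly independent over k. *)
Definition genus_at_least (n : nat) : Prop :=
  exists w : 'I_n -> (F -> F) -> F,
    (forall i, regular_differential (w i)) /\
    (forall a : 'I_n -> k,
       (forall d, derivation d -> \sum_(i < n) c (a i) * w i d = 0) ->
       forall i, a i = 0).

Definition hyperelliptic : Prop :=
  genus_at_least 2 /\ exists t : F, map_to_P1_of_degree 2 t.

End Curve.

(* Main.v *)
(* With y3 = y1 y2 / x, so that y3^2 = (x-1)(x-l1)(x-m)(x-m l2), the three
   differentials dx/y1, dx/y2, dx/y3 are regular on C.  Suppose C has a map t of
   degree 2 and write F = k(t) + k(t) s with s^2 in k(t).  The k(t)-part of
   (dx/dt)/y_i, times dt, is a regular differential on P^1, hence zero; so the
   ratios of the y_i lie in k(t), in particular y1/x and y2/x.  Since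
     (y1/x)^2 = x + l1/x - (1+l1),  (y2/x)^2 = x + m^2 l2/x - m(1+l2),
   l1 <> m^2 l2 would give x in k(t) and F = k(t).  Conversely, if l1 = m^2 l2,
   then Y1 = y1/x and Y2 = y2/x satisfy Y1^2 - Y2^2 = constant; this conic is
   parametrized by t = Y1 + Y2, and x is quadratic over k(t).  Finally
   D ((m l2 - l1)(m-1))^2 = ((1-l1)(1-l2)(m^2 l2 - l1))^2. *)
Require Import Defs.
From HB Require Import structures.
From mathcomp Require Import all_boot all_order all_algebra all_field.
From mathcomp Require Import boolp ring.

Set Implicit Arguments.
Unset Strict Implicit.
Unset Printing Implicit Defensive.

Import GRing.Theory.
Local Open Scope ring_scope.

(** The even part [a] of [d x / y = a + b * s] is half the trace of dx/y to P^1. Its regularity is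
    proved without points of C: over each point of P^1 the integral closure [A] of the local ring L
    is L + L s, once [s] is rescaled so that s^2 has order 0 or 1. Although [d] may create poles at
    ramification points, [s * d] maps [A] to itself. Hence s dx/y = b s^2 + a s lies in [A], and its
    coefficient [a] lies in L. The obstacle is that [A] may have two maximal ideals: [x] can be
    finite at one and infinite at the other, so that neither [x] nor [1 / x] lies in [A]. This is
    why a chart [1 / (x - g)] is needed, with one [g] that suits both. Separability of the quartics
    removes the division by [y]. Closed points of F serve only for the genus bound of the converse.
    There the delicate point is that [x] is not in k(t): otherwise [x] or [l1 / x] would be a
    monomial in [t] of degree at most 2, and comparing coefficients would give [l1 = 1]. *)

Section Subalgebras.

Variables (k F : fieldType) (c : {rmorphism k -> F}).

Definition ev (t : F) : {rmorphism {poly k} -> F} :=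
  (horner_eval t \o map_poly c).

Lemma evE t p : ev t p = (map_poly c p).[t].
Proof. by []. Qed.

Lemma evC t a : ev t a%:P = c a.
Proof. by rewrite evE map_polyC hornerC. Qed.

Lemma evX t : ev t 'X = t.
Proof. by rewrite evE map_polyX hornerX. Qed.

Lemma evXn t n : ev t 'X^n = t ^+ n.
Proof. by rewrite rmorphXn evX. Qed.

Lemma evCM t a p : ev t (a%:P * p) = c a * ev t p.
Proof. by rewrite rmorphM evC. Qed.

Definition subalgebra (A : F -> Prop) : Prop :=
  [/\ forall a, A (c a),
      forall a b, A a -> A b -> A (a - b)
    & forall a b, A a -> A b -> A (a * b)].

Section SubalgebraTheory.

Variables (A : F -> Prop) (alg : subalgebra A).

Lemma subalgC a : A (c a). Proof. by case: alg. Qed.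

Lemma subalgB a b : A a -> A b -> A (a - b). Proof. by case: alg => _ + _; apply. Qed.

Lemma subalgM a b : A a -> A b -> A (a * b). Proof. by case: alg => _ _; apply. Qed.

Lemma subalg0 : A 0. Proof. by rewrite -(rmorph0 c); apply: subalgC. Qed.

Lemma subalg1 : A 1. Proof. by rewrite -(rmorph1 c); apply: subalgC. Qed.

Lemma subalgN a : A a -> A (- a).
Proof. by move=> Aa; rewrite -sub0r; apply: subalgB => //; apply: subalg0. Qed.

Lemma subalgD a b : A a -> A b -> A (a + b).
Proof. by move=> Aa Ab; rewrite -[b]opprK; apply: subalgB => //; apply: subalgN. Qed.

Lemma subalg_nat n : A n%:R.
Proof. by rewrite -(rmorph_nat c); apply: subalgC. Qed.

Lemma subalgX a n : A a -> A (a ^+ n).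
Proof.
move=> Aa; elim: n => [|n IHn]; first exact: subalg1.
by rewrite exprS; apply: subalgM.
Qed.

Lemma subalg_ev a p : A a -> A (ev a p).
Proof.
move=> Aa; elim/poly_ind: p => [|p b IHp]; first by rewrite rmorph0; apply: subalg0.
rewrite rmorphD rmorphM evX evC; apply: subalgD; last exact: subalgC.
exact: subalgM.
Qed.

End SubalgebraTheory.

Definition is_subfield (E : F -> Prop) : Prop :=
  (forall a, E (c a)) /\ Defs.subfield_closed E.

Section FieldTheory.

Variables (E : F -> Prop) (fld : is_subfield E).

Lemma fld_div a b : E a -> E b -> E (a / b).
Proof. by case: fld => _ [_ _]; apply. Qed.

Lemma fldV a : E a -> E a^-1.
Proof. by move=> Ea; rewrite -div1r; apply: fld_div => //; case: fld => _ []. Qed.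

Lemma fld_subalg : subalgebra E.
Proof.
case: (fld) => Ec [E1 EB Ediv]; split=> // a b Ea Eb.
by rewrite -[b]invrK; apply: fld_div => //; apply: fldV.
Qed.

End FieldTheory.

Lemma derivation_rules (d : F -> F) : derivation c d ->
  [/\ d 0 = 0, d 1 = 0, forall a, d (- a) = - d a,
      forall a b, d (a - b) = d a - d b
    & forall a n, d (a ^+ n.+1) = n.+1%:R * a ^+ n * d a].
Proof.
case=> dD dM dC.
have d0 : d 0 = 0 by rewrite -{1}(rmorph0 c) dC.
have dN a : d (- a) = - d a.
  by apply/eqP; rewrite -addr_eq0 -dD addNr d0.
split=> //; first by rewrite -(rmorph1 c) dC.
  by move=> a b; rewrite dD dN.
move=> a; elim=> [|n IHn]; first by rewrite expr1 expr0 !mul1r.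
by rewrite exprS dM IHn (exprS a n) [in RHS]mulrS; ring.
Qed.

Lemma derivationV (d : F -> F) a : derivation c d -> d a^-1 = - d a / a ^+ 2.
Proof.
move=> der; have [d0 d1 _ _ _] := derivation_rules der; case: (der) => _ dM _.
have [->|a0] := eqVneq a 0; first by rewrite invr0 d0 oppr0 mul0r.
have := dM a a^-1; rewrite divff // d1 => H.
have : a * d a^-1 = - (a^-1 * d a) by apply/eqP; rewrite -addr_eq0 -H.
by move=> H2; apply: (mulfI a0); rewrite H2; field.
Qed.

Lemma derivation_ev (d : F -> F) a p : derivation c d ->
  d (ev a p) = ev a p^`() * d a.
Proof.
move=> der; have [d0 _ _ _ _] := derivation_rules der; case: (der) => dD dM dC.
elim/poly_ind: p => [|p b IHp]; first by rewrite deriv0 !rmorph0 mul0r.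
rewrite derivD derivM derivC derivX !rmorphD !rmorphM rmorph0 rmorph1 evX evC.
by rewrite dD dM dC IHp; ring.
Qed.

End Subalgebras.

(** * Quartics on P^1 and their Moebius transforms *)

Section Quartics.

Variable k : fieldType.

(* A quartic on P^1, as a product of four linear forms [a X + b]; a cubic is
   a quartic with the form [1] (a = 0, b = 1) as a factor. *)
Definition quartic (L : seq (k * k)) : {poly k} :=
  \prod_(l <- L) (l.1 *: 'X + l.2%:P).

Definition distinct_points (L : seq (k * k)) : bool :=
  all (fun l => (l.1 != 0) || (l.2 != 0)) L &&
  pairwise (fun l l' => l.1 * l'.2 != l'.1 * l.2) L.

(** The determinant of the two forms is their resultant, so constant Bezout coefficients exist. *)
Lemma coprimep_linear (l l' : k * k) : l.1 * l'.2 != l'.1 * l.2 ->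
  coprimep (l.1 *: 'X + l.2%:P) (l'.1 *: 'X + l'.2%:P).
Proof.
rewrite -subr_eq0 => D0; apply/Bezout_eq1_coprimepP.
set D := _ - _ in D0; exists ((- l'.1 / D)%:P, (l.1 / D)%:P) => /=.
rewrite -[1]/(1%:P) -(divff D0) {3}/D -!mul_polyC !(polyCM, polyCB, polyCN).
by ring.
Qed.

Lemma separable_linear (l : k * k) : (l.1 != 0) || (l.2 != 0) ->
  separable_poly (l.1 *: 'X + l.2%:P).
Proof.
move=> l0; rewrite unlock derivD derivZ derivX derivC addr0.
have [l1|l1] := eqVneq l.1 0; last by rewrite coprimepZr // coprimep1.
move: l0; rewrite l1 eqxx !scale0r add0r /= => l2.
by rewrite coprimep0 polyC_eqp1.
Qed.

Lemma separable_quartic L : distinct_points L -> separable_poly (quartic L).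
Proof.
rewrite /quartic /distinct_points; elim: L => [|l L IHL] /=.
  by rewrite big_nil unlock derivC coprimep0 eqpxx.
move=> /andP[/andP[l0 L0] /andP[lL LL]]; rewrite big_cons separable_mul.
rewrite separable_linear //= IHL ?L0 //=.
elim: L {IHL L0 LL} lL => [|l' L IHL] /=; first by rewrite big_nil coprimep1.
move=> /andP[ll' lL]; rewrite big_cons coprimepMr IHL // andbT.
exact: coprimep_linear.
Qed.

(** The substitution x = g + 1/u: at [u = 1 / (x - g)] the new form equals the old form at [x]
    divided by [x - g]. *)
Definition translate_points (g : k) (L : seq (k * k)) : seq (k * k) :=
  [seq (l.1 * g + l.2, l.1) | l <- L].

(** The substitution has determinant -1, so the pairwise determinants only change sign. *)
Lemma distinct_translate_points g L :
  distinct_points L -> distinct_points (translate_points g L).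
Proof.
rewrite /distinct_points /translate_points all_map pairwise_map.
move=> /andP[L0 LL]; apply/andP; split.
  apply: sub_all L0 => l /=; have [->|_] := eqVneq l.1 0; last by rewrite orbT.
  by rewrite mul0r add0r orbF.
apply: sub_pairwise LL => l l' /=; apply: contra => /eqP H.
apply/eqP; apply: (addrI (l.1 * l'.1 * g)).
by transitivity ((l'.1 * g + l'.2) * l.1); [ring | rewrite -H; ring].
Qed.

Variables (F : fieldType) (c : {rmorphism k -> F}).

Lemma ev_quartic x L :
  ev c x (quartic L) = \prod_(l <- L) (c l.1 * x + c l.2).
Proof.
rewrite /quartic rmorph_prod; apply: eq_bigr => l _.
by rewrite rmorphD -mul_polyC rmorphM evX !evC.
Qed.

Lemma ev_translate_points x g L : size L = 4%N -> x != c g ->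
  ev c (x - c g)^-1 (quartic (translate_points g L)) =
  ev c x (quartic L) / (x - c g) ^+ 4.
Proof.
move=> sL; rewrite -subr_eq0 => xg; rewrite !ev_quartic big_map -sL.
elim: {sL} L => [|l L IHL] /=; first by rewrite !big_nil expr0 divr1.
rewrite !big_cons IHL exprS rmorphD rmorphM; field.
by rewrite xg expf_neq0.
Qed.

End Quartics.

(** * The differential du/v on a double cover v^2 = g(u) *)

Section InvariantDifferential.

Variables (k F : fieldType) (c : {rmorphism k -> F}).

(* If [v^2 = g(u)] then [2 v dv = g'(u) du]; with [P g + Q g' = 1] this gives
   [du / v = P(u) v du + 2 Q(u) dv], in which [v] is not inverted. *)
Lemma invariant_differential (g : {poly k}) (u v : F) : separable_poly g ->
  v ^+ 2 = ev c u g -> v != 0 ->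
  exists P Q, forall d, derivation c d ->
    d u / v = ev c u P * v * d u + ev c u Q * d v.
Proof.
rewrite unlock => sep vg v0.
have /Bezout_eq1_coprimepP[[P Q] PQ] : coprimep g g^`() := sep.
change (P * g + Q * g^`() = 1) in PQ.
exists P, (2%:R * Q) => d der.
have [_ _ _ _ dX] := derivation_rules der.
have H := derivation_ev u g der.
have e1 : ev c u P * v ^+ 2 + ev c u Q * ev c u g^`() = 1.
  by rewrite vg -!rmorphM -rmorphD PQ rmorph1.
have e2 : ev c u g^`() * d u = 2%:R * v * d v by rewrite -H -vg dX expr1.
rewrite -[d u in LHS]mul1r -e1 mulrDl -[_ * _ * d u in X in _ + X]mulrA e2 rmorphM rmorph_nat.
by field.
Qed.

(* The chart [u = 1 / (x - g)], [v = y / (x - g)^2] of the double cover. *)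
Lemma chart_differential x y g d : derivation c d -> x != c g -> y != 0 ->
  d x / y = - (d (x - c g)^-1 / (y / (x - c g) ^+ 2)).
Proof.
move=> der; rewrite -subr_eq0 => xg y0; have [_ _ _ dB _] := derivation_rules der.
case: (der) => _ _ dC; rewrite (derivationV _ der) dB dC subr0; field.
by rewrite y0 xg.
Qed.

End InvariantDifferential.

Lemma poly_order0 (k : fieldType) (p : {poly k}) : p != 0 ->
  exists n q, q.[0] != 0 /\ p = q * 'X^n.
Proof.
move=> p0; have [n [q qP ->]] := multiplicity_XsubC p 0.
by exists n, q; rewrite subr0; split=> //; move: qP; rewrite p0.
Qed.

(** * The field k(t) and its discrete valuation ring at t = 0 *)

Section RationalFunctions.

Variables (k F : fieldType) (c : {rmorphism k -> F}).

Definition rat_in (t z : F) : Prop :=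
  exists p q, ev c t q != 0 /\ z = ev c t p / ev c t q.

(** The local ring of P^1 at the zero of [t]. The other points are reached by changing the
    coordinate: [t - c g] for the point g, [t^-1] for infinity. *)
Definition local_at (t z : F) : Prop :=
  exists p q : {poly k}, q.[0] != 0 /\ z = ev c t p / ev c t q.

Lemma rat_in_subfield t : is_subfield c (rat_in t).
Proof.
split; first by move=> a; exists a%:P, 1; rewrite evC rmorph1 divr1 oner_neq0.
split; first by exists 1, 1; rewrite rmorph1 divr1 oner_neq0.
  move=> _ _ [p [q [q0 ->]]] [p' [q' [q'0 ->]]].
  exists (p * q' - p' * q), (q * q'); rewrite rmorphB !rmorphM mulf_neq0 //.
  by split=> //; field; rewrite q0 q'0.
move=> _ _ [p [q [q0 ->]]] [p' [q' [q'0 ->]]].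
have [p'0|p'0] := eqVneq (ev c t p') 0.
  by exists 0, 1; rewrite p'0 rmorph0 rmorph1 oner_neq0 !mul0r invr0 mulr0.
exists (p * q'), (q * p'); rewrite !rmorphM mulf_neq0 //.
by split=> //; field; rewrite ?p'0 ?q0 ?q'0.
Qed.

Lemma rat_in_gen t : rat_in t t.
Proof. by exists 'X, 1; rewrite evX rmorph1 divr1 oner_neq0. Qed.

Lemma rat_in_sub (E : F -> Prop) t z : is_subfield c E -> E t -> rat_in t z -> E z.
Proof.
move=> fld Et [p [q [_ ->]]].
by apply: (fld_div fld); apply: (subalg_ev (fld_subalg fld)).
Qed.

Lemma in_adjoinP t z : in_adjoin c (eq t) z <-> rat_in t z.
Proof.
split=> [|tz P fld Pc Pt]; last by apply: (@rat_in_sub P t) => //; apply: Pt.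
have [Ec Ef] := rat_in_subfield t.
by apply=> // _ <-; apply: rat_in_gen.
Qed.

Variables (t : F) (tr : ~ algebraicOver c t).

Lemma ev_eq0 p : (ev c t p == 0) = (p == 0).
Proof.
have [->|p0] := eqVneq p 0; first by rewrite rmorph0 eqxx.
by apply/negP => tp; apply: tr; exists p.
Qed.

Lemma ev_inj : injective (ev c t).
Proof. by move=> p q /eqP; rewrite -subr_eq0 -rmorphB ev_eq0 subr_eq0 => /eqP. Qed.

Lemma gen_neq0 : t != 0.
Proof. by rewrite -[t](evX c) ev_eq0 polyX_eq0. Qed.

Lemma ev_neq0_of_horner (q : {poly k}) : q.[0] != 0 -> ev c t q != 0.
Proof. by rewrite ev_eq0; apply: contra => /eqP ->; rewrite horner0. Qed.

Lemma local_rat z : local_at t z -> rat_in t z.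
Proof. by case=> p [q [q0 ->]]; exists p, q; rewrite ev_neq0_of_horner. Qed.

Lemma local_subalg : subalgebra c (local_at t).
Proof.
split; first by move=> a; exists a%:P, 1; rewrite evC rmorph1 divr1 hornerC oner_neq0.
  move=> _ _ [p [q [q0 ->]]] [p' [q' [q'0 ->]]].
  exists (p * q' - p' * q), (q * q'); rewrite hornerM mulf_neq0 // rmorphB !rmorphM.
  by split=> //; field; rewrite !ev_neq0_of_horner.
move=> _ _ [p [q [q0 ->]]] [p' [q' [q'0 ->]]].
exists (p * p'), (q * q'); rewrite hornerM mulf_neq0 // !rmorphM.
by split=> //; field; rewrite !ev_neq0_of_horner.
Qed.

Lemma local_gen : local_at t t.
Proof. by exists 'X, 1; rewrite evX rmorph1 divr1 hornerC oner_neq0. Qed.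

Lemma local_genV : ~ local_at t t^-1.
Proof.
move=> [p [q [q0 E]]]; have eq0 := ev_neq0_of_horner q0; have t0 := gen_neq0.
have : ev c t q = ev c t ('X * p).
  by rewrite rmorphM evX; apply: (mulfI (invr_neq0 t0)); rewrite mulKf // [X in X * _]E divfK.
by move/ev_inj=> qE; move: q0; rewrite qE hornerM hornerX mul0r eqxx.
Qed.

(** Splitting off the powers of [t] from numerator and denominator compares their orders. The second
    case records a genuine pole: [z^-1] is in the maximal ideal. *)
Lemma local_or_inv z : rat_in t z ->
  local_at t z \/ exists2 w, local_at t w & z^-1 = t * w.
Proof.
move=> [p [q [q0 ->]]]; rewrite ev_eq0 in q0.
have [->|p0] := eqVneq p 0.
  by left; exists 0, 1; rewrite hornerC oner_neq0 rmorph0 !mul0r.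
have [i [p1 [p10 ->]]] := poly_order0 p0.
have [j [q1 [q10 ->]]] := poly_order0 q0.
have := ev_neq0_of_horner p10; have := ev_neq0_of_horner q10; have := gen_neq0.
rewrite !rmorphM !rmorphXn evX => t0 eq1 ep1.
have [ji|ij] := leqP j i.
  left; exists (p1 * 'X^(i - j)), q1; split=> //.
  rewrite rmorphM rmorphXn evX -(subnK ji) exprD addnK; field.
  by rewrite eq1 expf_neq0.
right; exists (ev c t (q1 * 'X^(j - i.+1)) / ev c t p1).
  by exists (q1 * 'X^(j - i.+1)), p1.
rewrite rmorphM rmorphXn evX -(subnKC ij) exprD exprS addKn; field.
by rewrite eq1 ep1 t0 !expf_neq0.
Qed.

Lemma local_derivation d z : derivation c d -> d t = 1 ->
  local_at t z -> local_at t (d z).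
Proof.
move=> der dt [p [q [q0 ->]]]; have eq0 := ev_neq0_of_horner q0.
exists (p^`() * q - p * q^`()), (q ^+ 2); rewrite horner_exp expf_neq0 //.
have [_ _ _ _ dX] := derivation_rules der; case: (der) => _ dM _.
split=> //; rewrite dM (derivationV _ der) !(derivation_ev _ _ der) dt.
by rewrite rmorphXn rmorphB !rmorphM; field.
Qed.

(* Scaling [s] by an element of k(t) brings the valuation of [s^2] at t = 0 to
   0 or 1. *)
Lemma local_normalize s : s != 0 -> rat_in t (s ^+ 2) ->
  exists e, [/\ rat_in t e, e != 0, local_at t ((e * s) ^+ 2)
    & forall b, rat_in t b -> local_at t ((e * s) ^+ 2 * b ^+ 2) -> local_at t b].
Proof.
move=> s0 [p [q [q0 sE]]]; have qn := q0; rewrite ev_eq0 in qn.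
have p0 : p != 0.
  apply: contraNneq s0 => p0; move/eqP: sE.
  by rewrite p0 rmorph0 mul0r expf_eq0.
have [i [p1 [p10 pE]]] := poly_order0 p0.
have [j [q1 [q10 qE]]] := poly_order0 qn.
have ep1 := ev_neq0_of_horner p10; have eq1 := ev_neq0_of_horner q10.
have t0 := gen_neq0.
(* The order i - j of s^2 has the parity of i + j, and multiplying s^2 by t^(2j - 2m) leaves the
   order i + j - 2m, which is 0 or 1. *)
pose m := (i + j)./2; pose e := t ^+ j / t ^+ m.
pose u := ev c t p1 / ev c t q1.
have hE : (e * s) ^+ 2 = t ^+ odd (i + j) * u.
  have : t ^+ i * t ^+ j = t ^+ odd (i + j) * t ^+ m * t ^+ m.
    by rewrite -!exprD -addnA addnn odd_double_half.
  move=> H; rewrite exprMn sE pE qE !rmorphM !rmorphXn evX /e /u.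
  have [ti tj tm] : [/\ t ^+ i != 0, t ^+ j != 0 & t ^+ m != 0] by rewrite !expf_neq0.
  transitivity (t ^+ i * t ^+ j * (ev c t p1 / ev c t q1) / (t ^+ m) ^+ 2).
    by field; rewrite tm tj eq1.
  by rewrite H; field; rewrite tm eq1.
have Lt := local_gen; have alg := local_subalg.
have Lu : local_at t u by exists p1, q1.
have LuV : local_at t u^-1 by exists q1, p1; rewrite invf_div.
have Et : rat_in t t := rat_in_gen t.
exists e; split.
- by apply: fld_div; [exact: rat_in_subfield|..];
    apply: (subalgX (fld_subalg (rat_in_subfield t))).
- by rewrite mulf_neq0 ?invr_neq0 ?expf_neq0.
- by rewrite hE; apply: (subalgM alg) => //; apply: (subalgX alg).
(* A pole of [b] contributes order at most -2 to the product and [(e * s) ^+ 2] at most 1, so [t^-1]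
   would be local. *)
move=> b Eb; rewrite hE => hb; have [//|[w Lw bE]] := local_or_inv Eb.
have [->|b0] := eqVneq b 0; first exact: subalg0 alg.
case: local_genV.
have u0 : u != 0 by rewrite mulf_neq0 ?invr_neq0.
set r := t ^+ _ * u * _ in hb.
have -> : t^-1 = u^-1 * (t ^+ (1 - odd (i + j)) * (w ^+ 2 * r)).
  have -> : w = b^-1 / t by rewrite bE mulrC mulKf.
  by rewrite /r; case: (odd (i + j)); rewrite ?expr1 /=; field; rewrite t0 b0 u0.
by repeat first [assumption | apply: (subalgM alg) | apply: (subalgX alg)].
Qed.

End RationalFunctions.

(** * Coordinates and norms in a quadratic extension *)

Section QuadraticExtension.

Variables (k F : fieldType) (c : {rmorphism k -> F}).
Variables (E : F -> Prop) (fld : is_subfield c E) (s : F) (sE : ~ E s).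

Lemma quad_uniq a b a' b' : E a -> E b -> E a' -> E b' ->
  a + b * s = a' + b' * s -> a = a' /\ b = b'.
Proof.
move=> Ea Eb Ea' Eb' eq_ab; have alg := fld_subalg fld.
have eq_b : (b - b') * s = a' - a.
  by apply/eqP; rewrite -subr_eq0 -(subrr (a + b * s)) {2}eq_ab; apply/eqP; ring.
have [/subr0_eq bb'|ne] := eqVneq (b - b') 0.
  by split=> //; move: eq_ab; rewrite bb' => /addIr.
case: sE; have -> : s = (a' - a) / (b - b') by rewrite -eq_b mulrC mulKf.
by apply: (fld_div fld); apply: (subalgB alg).
Qed.

Lemma quad_norm_eq0 a b : E a -> E b -> a ^+ 2 - s ^+ 2 * b ^+ 2 = 0 ->
  a = 0 /\ b = 0.
Proof.
move=> Ea Eb N0; have alg := fld_subalg fld; have E0 := subalg0 alg.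
have /eqP : (a + b * s) * (a + - b * s) = 0 by rewrite -N0; ring.
rewrite mulf_eq0 => /orP[] /eqP H.
  by apply: quad_uniq => //; rewrite H mul0r addr0.
have [-> b0] : a = 0 /\ - b = 0.
  by apply: quad_uniq => //; [apply: subalgN alg _ Eb | rewrite H mul0r addr0].
by split=> //; rewrite -[b]opprK b0 oppr0.
Qed.

End QuadraticExtension.

(** * Extending d/dt from k(t) to a quadratic extension *)

Section DerivationExistence.

Variables (k F : fieldType) (c : {rmorphism k -> F}).
Variables (t : F) (tr : ~ algebraicOver c t).

(** The quotient rule gives the same value for every fraction representing an element of k(t). The
    relation [P] expresses this independence, so choice turns it into a function; outside k(t) the
    value is immaterial. *)
Lemma rat_derivation : exists D : F -> F, forall p q, ev c t q != 0 ->
  D (ev c t p / ev c t q) =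
  (ev c t p^`() * ev c t q - ev c t p * ev c t q^`()) / ev c t q ^+ 2.
Proof.
pose P z w := forall p q, ev c t q != 0 -> z = ev c t p / ev c t q ->
  w = (ev c t p^`() * ev c t q - ev c t p * ev c t q^`()) / ev c t q ^+ 2.
suff /choice[D DP] : forall z, exists w, P z w.
  by exists D => p q q0; apply: DP.
move=> z; have [[p [q [q0 zE]]]|nz] := pselect (rat_in c t z); last first.
  by exists 0 => p q q0 zE; case: nz; exists p, q.
exists ((ev c t p^`() * ev c t q - ev c t p * ev c t q^`()) / ev c t q ^+ 2).
move=> p' q' q'0; rewrite zE => /eqP; rewrite eqr_div // => /eqP pq.
(* Transcendence of [t] lifts the equality of fractions to a polynomial identity, which is then
   differentiated. *)
have := congr1 deriv (ev_inj tr (etrans (rmorphM _ _ _) (etrans pq (esym (rmorphM _ _ _))))).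
move/(congr1 (ev c t)); rewrite !derivM !rmorphD !rmorphM => dpq.
have p'E : ev c t p' = ev c t p * ev c t q' / ev c t q by rewrite pq mulfK.
have dp'E : ev c t p'^`() = (ev c t p^`() * ev c t q' + ev c t p * ev c t q'^`()
    - ev c t p' * ev c t q^`()) / ev c t q by rewrite dpq addrK mulfK.
by rewrite dp'E p'E; field; rewrite q0 q'0.
Qed.

Hypothesis two : 2%:R != 0 :> F.
Variable s : F.
Hypotheses (s2E : rat_in c t (s ^+ 2)) (sE : ~ rat_in c t s).
Hypothesis gen : forall z, exists a b,
  [/\ rat_in c t a, rat_in c t b & z = a + b * s].

(** Differentials are encoded as functions on derivations, so statements about dx/y are tested on
    this derivation, for which [d x] plays the role of dx/dt. *)
Lemma derivation_exists : exists2 D, derivation c D & D t = 1.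
Proof.
have [D0 D0E] := rat_derivation.
have fld := rat_in_subfield c t; have alg := fld_subalg fld.
have D0D a b : rat_in c t a -> rat_in c t b -> D0 (a + b) = D0 a + D0 b.
  move=> [p [q [q0 ->]]] [p' [q' [q'0 ->]]]; rewrite addf_div // -!rmorphM -rmorphD.
  rewrite !D0E ?rmorphM ?mulf_neq0 // !derivE !rmorphD !rmorphM; field.
  by rewrite q0 q'0.
have D0M a b : rat_in c t a -> rat_in c t b -> D0 (a * b) = a * D0 b + b * D0 a.
  move=> [p [q [q0 ->]]] [p' [q' [q'0 ->]]]; rewrite mulf_div -!rmorphM.
  rewrite !D0E ?rmorphM ?mulf_neq0 // !derivE !rmorphD !rmorphM; field.
  by rewrite q0 q'0.
have D0p p : D0 (ev c t p) = ev c t p^`().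
  have := D0E p 1; rewrite rmorph1 oner_neq0 divr1 derivC rmorph0 => -> //.
  by rewrite expr1n mulr0 subr0 divr1 mulr1.
have s0 : s != 0 by apply: contra_notN sE => /eqP ->; apply: subalg0 alg.
(* The value D s = D0(s^2) / (2 s) is forced by differentiating s^2. *)
pose Dab a b := D0 a + D0 b * s + b * D0 (s ^+ 2) / (2%:R * s).
have [D DE] : exists D, forall a b, rat_in c t a -> rat_in c t b ->
    D (a + b * s) = Dab a b.
  pose P z w := forall a b, rat_in c t a -> rat_in c t b -> z = a + b * s -> w = Dab a b.
  suff /choice[D DP] : forall z, exists w, P z w.
    by exists D => a b Ea Eb; apply: DP.
  move=> z; have [a [b [Ea Eb ->]]] := gen z; exists (Dab a b) => a' b' Ea' Eb' e.
  by have [-> ->] := quad_uniq fld sE Ea Eb Ea' Eb' e.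
have E0 : rat_in c t 0 := subalg0 alg.
have D00 : D0 0 = 0 by rewrite -(rmorph0 (ev c t)) D0p deriv0.
have DE0 a : rat_in c t a -> D a = D0 a.
  move=> Ea; have := DE a 0 Ea E0; rewrite /Dab D00 !mul0r !addr0; exact.
have EDadd x y : rat_in c t x -> rat_in c t y -> rat_in c t (x + y) by exact: (subalgD alg).
have EM x y : rat_in c t x -> rat_in c t y -> rat_in c t (x * y) by exact: (subalgM alg).
exists D; last first.
  have := D0p 'X; rewrite evX derivX rmorph1 DE0 //; exact: rat_in_gen.
split.
- move=> z z'; have [a [b [Ea Eb ->]]] := gen z; have [a' [b' [Ea' Eb' ->]]] := gen z'.
  have -> : a + b * s + (a' + b' * s) = (a + a') + (b + b') * s by ring.
  by rewrite !DE /Dab ?D0D; auto; ring.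
- move=> z z'; have [a [b [Ea Eb ->]]] := gen z; have [a' [b' [Ea' Eb' ->]]] := gen z'.
  have -> : (a + b * s) * (a' + b' * s) =
    (a * a' + b * b' * s ^+ 2) + (a * b' + b * a') * s by ring.
  have e1 : D0 (a * a' + b * b' * s ^+ 2) = a * D0 a' + a' * D0 a +
      (b * b' * D0 (s ^+ 2) + s ^+ 2 * (b * D0 b' + b' * D0 b)).
    by rewrite D0D ?(D0M a) ?(D0M (b * b')) ?(D0M b); auto.
  rewrite !DE; auto; rewrite /Dab e1 D0D ?(D0M a b') ?(D0M b a'); auto.
  by field; rewrite s0 two.
- move=> a; have Ec : rat_in c t (c a) by case: fld.
  by rewrite DE0 // -(evC c t) D0p derivC rmorph0.
Qed.

End DerivationExistence.

(** * The integral closure in F of a local ring of P^1, and the even part of dx/y *)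

Section LocalRing.

Variables (k F : fieldType) (c : {rmorphism k -> F}).
Hypothesis two : 2%:R != 0 :> F.
Variables (t : F) (tr : ~ algebraicOver c t).

Lemma local_sqr a : rat_in c t a -> local_at c t (a ^+ 2) -> local_at c t a.
Proof.
have alg := local_subalg tr.
move=> Ea La2; have [//|[w Lw aE]] := local_or_inv tr Ea.
have [->|a0] := eqVneq a 0; first exact: subalg0 alg.
have -> : a = a ^+ 2 * (t * w) by rewrite -aE; field.
by do 2?apply: (subalgM alg) => //; apply: local_gen.
Qed.

Lemma local_quotient a b : rat_in c t a -> rat_in c t b ->
  local_at c t (a / b) \/ local_at c t (b / a).
Proof.
move=> Ea Eb; have alg := local_subalg tr.
have [|[w Lw abE]] := local_or_inv tr (fld_div (rat_in_subfield c t) Ea Eb); first by left.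
by right; rewrite -invf_div abE; apply: (subalgM alg) => //; apply: local_gen.
Qed.

(** Divisibility in a valuation ring is a total preorder, so one of three elements has least
    order. *)
Lemma local_min3 (I : Type) (G : I -> F) (i j l : I) :
    (forall i, rat_in c t (G i) /\ G i != 0) -> exists m,
  [/\ local_at c t (G i / G m), local_at c t (G j / G m) & local_at c t (G l / G m)].
Proof.
move=> EG; have alg := local_subalg tr.
have le_refl a : local_at c t (G a / G a).
  by rewrite divff ?(EG a).2 //; apply: subalg1 alg.
have le_total a b : local_at c t (G a / G b) \/ local_at c t (G b / G a).
  by apply: local_quotient; apply: (EG _).1.
have le_trans b a e : local_at c t (G a / G b) -> local_at c t (G b / G e) ->
    local_at c t (G a / G e).
  move=> ab be; have -> : G a / G e = G a / G b * (G b / G e).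
    by field; rewrite (EG b).2 (EG e).2.
  exact: subalgM alg _ _ ab be.
case: (le_total i j) => ij.
  by case: (le_total j l) => jl; [exists l | exists j]; split=> //; apply: le_trans jl.
by case: (le_total i l) => il; [exists l | exists i]; split=> //; apply: le_trans il.
Qed.

Section QuadraticLocalRing.

Variable s : F.
Hypotheses (s2E : rat_in c t (s ^+ 2)) (sE : ~ rat_in c t s).
Hypothesis gen : forall z, exists a b,
  [/\ rat_in c t a, rat_in c t b & z = a + b * s].
Hypothesis s2L : local_at c t (s ^+ 2).
(** Amounts to s^2 having order at most 1 at t = 0; without it [1, s] would not be a basis of the
    integral closure. [local_normalize] provides it. *)
Hypothesis s2_norm : forall b, rat_in c t b ->
  local_at c t (s ^+ 2 * b ^+ 2) -> local_at c t b.

Let fld := rat_in_subfield c t.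
Let ealg := fld_subalg fld.
Let lalg := local_subalg tr.

(* The integral closure in F of the local ring of P^1 at t = 0. *)
Let A (z : F) := exists a b, [/\ local_at c t a, local_at c t b & z = a + b * s].

Lemma quad_local_subalg : subalgebra c A.
Proof.
split.
- move=> a; exists (c a), 0; split; [exact: (subalgC lalg) | exact: (subalg0 lalg) | by rewrite mul0r addr0].
- move=> _ _ [a [b [La Lb ->]]] [a' [b' [La' Lb' ->]]].
  by exists (a - a'), (b - b'); split; [exact: (subalgB lalg) | exact: (subalgB lalg) | ring].
move=> _ _ [a [b [La Lb ->]]] [a' [b' [La' Lb' ->]]].
exists (a * a' + b * b' * s ^+ 2), (a * b' + b * a'); split; last by ring.
  by apply: (subalgD lalg); do ?[apply: (subalgM lalg) => //].
by apply: (subalgD lalg); apply: (subalgM lalg).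
Qed.

Let aalg := quad_local_subalg.

Lemma quad_local_coef a b : rat_in c t a -> rat_in c t b -> A (a + b * s) ->
  local_at c t a /\ local_at c t b.
Proof.
move=> Ea Eb [a' [b' [La' Lb' eq_ab]]].
have [] := quad_uniq fld sE Ea Eb (local_rat tr La') (local_rat tr Lb') eq_ab.
by move=> -> ->.
Qed.

Lemma half_local a : local_at c t (2%:R * a) -> local_at c t a.
Proof.
move=> La; have -> : a = c 2%:R^-1 * (2%:R * a) by rewrite fmorphV rmorph_nat mulKf.
by apply: (subalgM lalg) => //; apply: (subalgC lalg).
Qed.

(** Integrality of an element of a quadratic extension is read off its trace 2a and its norm: they
    bound s^2 b^2, hence [b]. *)
Lemma quad_local_trace_norm a b : rat_in c t b ->
  local_at c t (2%:R * a) -> local_at c t (a ^+ 2 - s ^+ 2 * b ^+ 2) ->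
  A (a + b * s).
Proof.
move=> Eb /half_local La LN; exists a, b; split=> //; apply: s2_norm => //.
have -> : s ^+ 2 * b ^+ 2 = a ^+ 2 - (a ^+ 2 - s ^+ 2 * b ^+ 2) by ring.
by apply: (subalgB lalg) => //; apply: (subalgX lalg).
Qed.

(** A case of integral closedness, used to put the second coordinate of a chart in [A]. The square
    of the norm of [v] is the norm of v^2, so the norm is local; added to and subtracted from the
    coefficient a^2 + s^2 b^2 of v^2, it isolates a^2 and s^2 b^2. *)
Lemma quad_local_sqrt v : A (v ^+ 2) -> A v.
Proof.
have [a [b [Ea Eb ->]]] := gen v.
have -> : (a + b * s) ^+ 2 = (a ^+ 2 + s ^+ 2 * b ^+ 2) + (2%:R * (a * b)) * s by ring.
have Ea2 := subalgX ealg 2 Ea; have Eb2 := subalgM ealg s2E (subalgX ealg 2 Eb).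
move=> /quad_local_coef[||La Lb].
- exact: (subalgD ealg).
- by apply: (subalgM ealg); [exact: subalg_nat ealg _ | exact: (subalgM ealg)].
have LN : local_at c t (a ^+ 2 - s ^+ 2 * b ^+ 2).
  apply: local_sqr; first exact: (subalgB ealg).
  have -> : (a ^+ 2 - s ^+ 2 * b ^+ 2) ^+ 2 =
    (a ^+ 2 + s ^+ 2 * b ^+ 2) ^+ 2 - s ^+ 2 * (2%:R * (a * b)) ^+ 2 by ring.
  by apply: (subalgB lalg); [|apply: (subalgM lalg) => //]; apply: (subalgX lalg).
exists a, b; split=> //.
  apply: local_sqr => //; apply: half_local.
  have -> : 2%:R * a ^+ 2 = (a ^+ 2 + s ^+ 2 * b ^+ 2) + (a ^+ 2 - s ^+ 2 * b ^+ 2) by ring.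
  exact: (subalgD lalg).
apply: s2_norm => //; apply: half_local.
have -> : 2%:R * (s ^+ 2 * b ^+ 2) =
  (a ^+ 2 + s ^+ 2 * b ^+ 2) - (a ^+ 2 - s ^+ 2 * b ^+ 2) by ring.
exact: (subalgB lalg).
Qed.

Variable d : F -> F.
Hypotheses (der : derivation c d) (dt : d t = 1).

(** The factor [s] clears the only possible pole, that of d s = d(s^2) / (2 s): it bounds the
    different of [A] over the local ring. *)
Lemma quad_local_derivation z : A z -> A (s * d z).
Proof.
move=> [a [b [La Lb ->]]]; have [dD dM _] := der.
have [_ _ _ _ dX] := derivation_rules der.
exists (s ^+ 2 * d b + b * (d (s ^+ 2) / 2%:R)), (d a).
have Ld u : local_at c t u -> local_at c t (d u) by apply: (local_derivation tr der dt).
have LM u v : local_at c t u -> local_at c t v -> local_at c t (u * v).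
  exact: (subalgM lalg).
split; [|exact: Ld|by rewrite dD dM dX; field].
apply: (subalgD lalg); apply: (LM) => //; first exact: Ld.
by apply: half_local; rewrite mulrC divfK //; apply: Ld.
Qed.

(* The norms of [x - g], for g = 0, 1, -1, span those of [x - g] for all [g],
   the trace of [x] and 1; so some [1 / (x - g)] has local trace and norm. *)
Lemma quad_local_chart x : (forall g, x != c g) -> exists g, A (x - c g)^-1.
Proof.
move=> xc; have [a [b [Ea Eb xE]]] := gen x.
have Ec g : rat_in c t (c g) by case: fld.
pose G g := (a - c g) ^+ 2 - s ^+ 2 * b ^+ 2.
have EG g : rat_in c t (G g) /\ G g != 0.
  have Eac : rat_in c t (a - c g) by apply: (subalgB ealg).
  split.
    by apply: (subalgB ealg); [|apply: (subalgM ealg) => //]; apply: (subalgX ealg).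
  apply/eqP => G0; have [ac b0] := quad_norm_eq0 fld sE Eac Eb G0.
  by move/eqP: (xc g); apply; rewrite xE b0 mul0r addr0; apply: subr0_eq.
have [g [L0 L1 LN1]] := local_min3 0 1 (-1) EG.
have Gg0 := (EG g).2.
have c2 : 2%:R = c 2%:R by rewrite rmorph_nat.
have c2V : 2%:R^-1 = c 2%:R^-1 by rewrite fmorphV rmorph_nat.
(* The identities are G(1) + G(-1) - 2 G(0) = 2 and, for the trace below, G(-1) - G(1) = 4 a.
   Dividing by the [G g] of least order makes every term local. *)
have LGV : local_at c t (G g)^-1.
  have -> : (G g)^-1 = c 2%:R^-1 * (G 1 / G g + G (-1) / G g) - G 0 / G g.
    rewrite -c2V; have -> : G 0 = a ^+ 2 - s ^+ 2 * b ^+ 2 by rewrite /G rmorph0 subr0.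
    have -> : G 1 = (a - 1) ^+ 2 - s ^+ 2 * b ^+ 2 by rewrite /G rmorph1.
    have -> : G (-1) = (a + 1) ^+ 2 - s ^+ 2 * b ^+ 2 by rewrite /G rmorphN1 opprK.
    by field; rewrite Gg0 two.
  apply: (subalgB lalg) => //; apply: (subalgM lalg); first exact: (subalgC lalg).
  exact: (subalgD lalg).
have LaV : local_at c t (2%:R * (a / G g)).
  have -> : 2%:R * (a / G g) = c 2%:R^-1 * (G (-1) / G g - G 1 / G g).
    rewrite -c2V; have -> : G 1 = (a - 1) ^+ 2 - s ^+ 2 * b ^+ 2 by rewrite /G rmorph1.
    have -> : G (-1) = (a + 1) ^+ 2 - s ^+ 2 * b ^+ 2 by rewrite /G rmorphN1 opprK.
    by field; rewrite Gg0 two.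
  by apply: (subalgM lalg); [exact: (subalgC lalg) | exact: (subalgB lalg)].
exists g; have GE : G g = (a - c g + b * s) * (a - c g - b * s) by rewrite /G; ring.
have [x0 x'0] : a - c g + b * s != 0 /\ a - c g - b * s != 0.
  by move: Gg0; rewrite GE mulf_eq0 negb_or => /andP.
have -> : (x - c g)^-1 = (a - c g) / G g + (- b / G g) * s.
  rewrite GE xE addrAC; field; rewrite ?x'0 ?x0 //.
apply: quad_local_trace_norm.
- by apply: (fld_div fld); [exact: (subalgN ealg) | exact: (EG g).1].
- have -> : 2%:R * ((a - c g) / G g) = 2%:R * (a / G g) - 2%:R * c g * (G g)^-1 by field.
  apply: (subalgB lalg) => //; apply: (subalgM lalg) => //.
  by rewrite c2; apply: (subalgM lalg); apply: (subalgC lalg).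
have -> // : ((a - c g) / G g) ^+ 2 - s ^+ 2 * (- b / G g) ^+ 2 = (G g)^-1.
by rewrite -[X in _ = X](mulfK Gg0) -[X in _ = X / _]mulrC {3}/G; field.
Qed.

(** In the chart [u], [v] the product s dx/y becomes, up to sign, P v (s du) + Q (s dv), where each
    term lies in [A]. Since s (a + b s) = b s^2 + a s, its coefficient along [s] is [a]. *)
Lemma even_part_local_normalized L x y a b : distinct_points L -> size L = 4%N ->
  (forall g, x != c g) -> y != 0 -> y ^+ 2 = ev c x (quartic L) ->
  rat_in c t a -> rat_in c t b -> d x / y = a + b * s -> local_at c t a.
Proof.
move=> dL sL xc y0 yE Ea Eb xyE; have [g Au] := quad_local_chart xc.
have xg0 : x - c g != 0 by rewrite subr_eq0.
pose u := (x - c g)^-1; pose v := y / (x - c g) ^+ 2.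
have v0 : v != 0 by rewrite mulf_neq0 ?invr_neq0 ?expf_neq0.
have vE : v ^+ 2 = ev c u (quartic (translate_points g L)).
  by rewrite ev_translate_points // -yE /v; field.
have Av : A v by apply: quad_local_sqrt; rewrite vE; apply: (subalg_ev aalg).
have sep := separable_quartic (distinct_translate_points g dL).
have [P [Q PQ]] := invariant_differential sep vE v0.
have : A (s * (d x / y)).
  rewrite (chart_differential der (xc g) y0) -/u -/v PQ // mulrN.
  apply: (subalgN aalg).
  have -> : s * (ev c u P * v * d u + ev c u Q * d v) =
    ev c u P * v * (s * d u) + ev c u Q * (s * d v) by ring.
  have Aev p := subalg_ev aalg p Au.
  apply: (subalgD aalg); apply: (subalgM aalg); try exact: quad_local_derivation.
    by apply: (subalgM aalg); [exact: Aev|].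
  exact: Aev.
have -> : s * (d x / y) = b * s ^+ 2 + a * s by rewrite xyE; ring.
by case/quad_local_coef => //; apply: (subalgM ealg).
Qed.

End QuadraticLocalRing.

(** Replacing [s] by the normalized [e * s] changes [b] to [b / e] but leaves [a] alone. *)
Lemma even_part_local s d L x y a b :
  rat_in c t (s ^+ 2) -> ~ rat_in c t s ->
  (forall z, exists a b, [/\ rat_in c t a, rat_in c t b & z = a + b * s]) ->
  derivation c d -> d t = 1 ->
  distinct_points L -> size L = 4%N ->
  (forall g, x != c g) -> y != 0 -> y ^+ 2 = ev c x (quartic L) ->
  rat_in c t a -> rat_in c t b -> d x / y = a + b * s -> local_at c t a.
Proof.
move=> s2E sE gen der dt dL sL xc y0 yE Ea Eb xyE.
have fld := rat_in_subfield c t; have alg := fld_subalg fld.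
have s0 : s != 0 by apply: contra_notN sE => /eqP ->; apply: subalg0 alg.
have [e [Ee e0 es2 es_norm]] := local_normalize tr s0 s2E.
have EeV z : rat_in c t z -> rat_in c t (z / e) by move=> ?; apply: (fld_div fld).
apply: (@even_part_local_normalized (e * s) _ _ _ es2 es_norm d der dt L x y a (b / e)) => //.
- exact: (local_rat tr).
- move=> Ees; apply: sE; have -> : s = e * s / e by field.
  exact: EeV.
- move=> z; have [z0 [z1 [Ez0 Ez1 ->]]] := gen z.
  by exists z0, (z1 / e); split=> //; [exact: EeV | field].
- exact: EeV.
by rewrite xyE; field.
Qed.

End LocalRing.

(** * From local regularity at every point of P^1 to vanishing *)

Section NoRegularDifferential.

Variables (k : closedFieldType) (F : fieldType) (c : {rmorphism k -> F}).

Lemma ev_comp (t : F) p q : ev c t (p \Po q) = ev c (ev c t q) p.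
Proof.
elim/poly_ind: p => [|p b IHp]; first by rewrite comp_poly0 !rmorph0.
by rewrite comp_polyD comp_polyM comp_polyX comp_polyC !rmorphD !rmorphM IHp !evC evX.
Qed.

Lemma transcendental_neq (t : F) g : ~ algebraicOver c t -> t != c g.
Proof. by move=> tr; apply: contra_notN tr => /eqP ->; apply: algebraic_id. Qed.

Variables (t : F) (tr : ~ algebraicOver c t).

Lemma transcendental_shift g : ~ algebraicOver c (t - c g).
Proof.
move=> H; apply: tr; rewrite -[t](subrK (c g)).
by apply: algebraic_add => //; apply: algebraic_id.
Qed.

Lemma transcendental_inv : ~ algebraicOver c t^-1.
Proof. by move=> H; apply: tr; rewrite -[t]invrK; apply: algebraic_inv. Qed.

Lemma rat_in_shift g z : rat_in c (t - c g) z <-> rat_in c t z.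
Proof.
have [fld fldg] := (rat_in_subfield c t, rat_in_subfield c (t - c g)).
split; apply: rat_in_sub => //.
  by apply: (subalgB (fld_subalg fld)); [exact: rat_in_gen | case: fld].
rewrite -[t in X in _ X](subrK (c g)).
by apply: (subalgD (fld_subalg fldg)); [exact: rat_in_gen | case: fldg].
Qed.

Lemma rat_in_inv z : rat_in c t^-1 z <-> rat_in c t z.
Proof.
split; apply: rat_in_sub; try exact: rat_in_subfield.
  by apply: (fldV (rat_in_subfield c t)); apply: rat_in_gen.
by rewrite -[X in rat_in _ _ X]invrK; apply: (fldV (rat_in_subfield c _)); apply: rat_in_gen.
Qed.

Lemma rat_in_coprime z : rat_in c t z ->
  exists p q, [/\ coprimep p q, q != 0 & z = ev c t p / ev c t q].
Proof.
move=> [p [q [q0 ->]]]; rewrite ev_eq0 // in q0.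
have g0 : gcdp p q != 0 by rewrite gcdp_eq0 negb_and q0 orbT.
have qE := divpK (dvdp_gcdr p q); have pE := divpK (dvdp_gcdl p q).
exists (p %/ gcdp p q), (q %/ gcdp p q); split.
- by apply: coprimep_div_gcd; rewrite q0 orbT.
- by apply: contraNneq q0 => q1; rewrite -qE q1 mul0r.
have -> : ev c t p = ev c t (p %/ gcdp p q) * ev c t (gcdp p q) by rewrite -rmorphM pE.
have -> : ev c t q = ev c t (q %/ gcdp p q) * ev c t (gcdp p q) by rewrite -rmorphM qE.
by rewrite -mulf_div divff ?mulr1 // ev_eq0.
Qed.

(** Over a closed field a nonconstant reduced denominator has a root g, which would be a pole at t =
    g. *)
Lemma poly_of_local_everywhere z : rat_in c t z ->
  (forall g, local_at c (t - c g) z) -> exists p, z = ev c t p.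
Proof.
move=> Ez Lz; have [p [q [pq q0 zE]]] := rat_in_coprime Ez.
have [/size_poly1P[b b0 qE]|] := boolP (size q == 1%N).
  by exists (b^-1 *: p); rewrite -mul_polyC rmorphM zE qE !evC fmorphV mulrC.
move=> /closed_rootP[g qg]; have [p' [q' [q'0 zE']]] := Lz g.
have eE r : ev c (t - c g) r = ev c t (r \Po ('X - g%:P)).
  by rewrite ev_comp rmorphB evX evC.
have q'g : (q' \Po ('X - g%:P)).[g] != 0.
  by rewrite horner_comp !hornerE subrr.
have eq'0 : ev c t (q' \Po ('X - g%:P)) != 0.
  by rewrite ev_eq0 //; apply: contraNneq q'g => ->; rewrite horner0.
have eq0 : ev c t q != 0 by rewrite ev_eq0.
move/eqP: zE'; rewrite zE !eE eqr_div // -!rmorphM => /eqP/(ev_inj tr).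
move/(congr1 (fun r => r.[g])); rewrite !hornerM (rootP qg) mulr0 => /eqP.
rewrite mulf_eq0 (negPf q'g) orbF => pg.
by have := coprimep_root pq pg; rewrite (rootP qg) eqxx.
Qed.

Lemma local_infinity_polyV p : local_at c t^-1 (ev c t p)^-1.
Proof.
have alg := local_subalg transcendental_inv.
have [r ->] := closed_field_poly_normal p.
rewrite -mul_polyC rmorphM evC invfM -fmorphV.
apply: (subalgM alg); first exact: (subalgC alg).
elim: r => [|g r IHr]; first by rewrite big_nil rmorph1 invr1; apply: (subalg1 alg).
rewrite big_cons rmorphM invfM; apply: (subalgM alg) => //.
have t0 := gen_neq0 tr.
(* With u = 1/t, the factor 1 / (t - g) is u / (1 - g u), whose denominator is 1 at u = 0. *)
exists 'X, (1 - g *: 'X); rewrite !hornerE ?mulr0 ?subr0 oner_neq0; split=> //.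
rewrite !rmorphB -mul_polyC rmorphM rmorph1 evX !evC.
have tg : t - c g != 0 by rewrite subr_eq0; apply: transcendental_neq.
have -> : 1 - c g / t = (t - c g) / t by field.
by rewrite evX; field; rewrite tg t0.
Qed.

(* The projective line carries no nonzero regular differential [z dt]. *)
Lemma regular_on_line_eq0 z : rat_in c t z ->
  (forall g, local_at c (t - c g) z) -> local_at c t^-1 (t ^+ 2 * z) -> z = 0.
Proof.
move=> Ez Lz Linf; have [p zE] := poly_of_local_everywhere Ez Lz.
have alg := local_subalg transcendental_inv; have t0 := gen_neq0 tr.
apply/eqP/negPn/negP => z0; apply: (local_genV transcendental_inv).
(* As [z] is a nonzero polynomial in [t], [z^-1] is local at infinity; all three factors then are,
   and so would be [t] itself. *)
have -> : t^-1^-1 = t ^+ 2 * z * z^-1 * t^-1 by field; rewrite t0 z0 oner_neq0.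
apply: (subalgM alg); last exact: local_gen.
by apply: (subalgM alg) => //; rewrite zE; apply: local_infinity_polyV.
Qed.

Hypothesis two : 2%:R != 0 :> F.

Lemma even_part_eq0 s d L x y a b :
  rat_in c t (s ^+ 2) -> ~ rat_in c t s ->
  (forall z, exists a b, [/\ rat_in c t a, rat_in c t b & z = a + b * s]) ->
  derivation c d -> d t = 1 ->
  distinct_points L -> size L = 4%N ->
  (forall g, x != c g) -> y != 0 -> y ^+ 2 = ev c x (quartic L) ->
  rat_in c t a -> rat_in c t b -> d x / y = a + b * s -> a = 0.
Proof.
move=> s2E sE gen der dt dL sL xc y0 yE Ea Eb xyE.
have [_ _ _ dB _] := derivation_rules der; case: (der) => dD dM dC.
apply: regular_on_line_eq0 => // [g|].
  apply: (even_part_local two (transcendental_shift (g := g)) (s := s) (d := d)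
    (L := L) (x := x) (y := y) (a := a) (b := b)) => //;
    rewrite ?rat_in_shift //.
  - move=> z; have [z0 [z1 [Ez0 Ez1 ->]]] := gen z.
    by exists z0, z1; split=> //; apply/rat_in_shift.
  - by rewrite dB dC subr0.
have t0 := gen_neq0 tr.
have tinv : rat_in c t t := rat_in_gen c t.
have alg := fld_subalg (rat_in_subfield c t).
have -> : t ^+ 2 * a = - (- t ^+ 2 * a) by ring.
apply: (subalgN (local_subalg transcendental_inv)).
(* At infinity the coordinate is 1/t, and the derivation taking the value 1 on it is -t^2 d; it
   multiplies the even part by -t^2. *)
apply: (even_part_local two transcendental_inv (s := s) (d := fun z => - t ^+ 2 * d z)
    (L := L) (x := x) (y := y) (b := - t ^+ 2 * b)) => //;
    rewrite ?rat_in_inv //.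
- move=> z; have [z0 [z1 [Ez0 Ez1 ->]]] := gen z.
  by exists z0, z1; split=> //; apply/rat_in_inv.
- by split=> [u v|u v|g]; rewrite ?dD ?dM ?dC; ring.
- by rewrite (derivationV _ der) dt; field.
- by apply: (subalgM alg) => //; apply: (subalgN alg); apply: (subalgX alg).
- by apply: (subalgM alg) => //; apply: (subalgN alg); apply: (subalgX alg).
by rewrite -!mulrA xyE; ring.
Qed.

End NoRegularDifferential.

(** * Field extensions of degree 2, and regular differentials at closed points *)

Lemma quadratic_generator (k F : fieldType) (c : {rmorphism k -> F})
    (E : F -> Prop) : 2%:R != 0 :> F -> is_subfield c E -> degree_over E 2 ->
  exists s, [/\ E (s ^+ 2), ~ E s
    & forall z, exists a b, [/\ E a, E b & z = a + b * s]].
Proof.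
move=> two fld [e eP]; have alg := fld_subalg fld.
have E0 : E 0 := subalg0 alg; have E1 : E 1 := subalg1 alg.
have span z : exists a b, [/\ E a, E b & z = a * e 0 + b * e 1].
  have [a [[Ea ->] _]] := eP z.
  by exists (a 0), (a 1); split=> //; rewrite big_ord_recl big_ord1; congr (_ + a _ * e _); apply: val_inj.
have indep a b : E a -> E b -> a * e 0 + b * e 1 = 0 -> a = 0 /\ b = 0.
  move=> Ea Eb ab0; have [f [_ fP]] := eP 0.
  have f0 : f = [ffun => 0].
    by apply: fP; split=> [i|]; [rewrite ffunE | rewrite big1 // => i _; rewrite ffunE mul0r].
  have : f = [ffun i : 'I_2 => if i == 0 then a else b].
    apply: fP; split=> [i|]; first by rewrite ffunE; case: ifP.
    rewrite big_ord_recl big_ord1 !ffunE /= -[LHS]ab0; congr (_ + _ * e _).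
    exact: val_inj.
  rewrite f0 => /ffunP fab; split.
    by have := fab 0; rewrite !ffunE.
  by have := fab 1; rewrite !ffunE.
(* Basis exchange: if [e0] has a nonzero coefficient in the expansion of 1, then [1, e1] is again a
   basis. *)
have main e0 e1 : (forall z, exists a b, [/\ E a, E b & z = a * e0 + b * e1]) ->
    (forall a b, E a -> E b -> a * e0 + b * e1 = 0 -> a = 0 /\ b = 0) ->
    forall a b, E a -> E b -> a != 0 -> 1 = a * e0 + b * e1 ->
  ~ E e1 /\ forall z, exists a b, [/\ E a, E b & z = a + b * e1].
  move=> span' indep' a b Ea Eb a0 e01.
  have e0E : e0 = a^-1 + - (b / a) * e1.
    have ae0 : a * e0 = 1 - b * e1 by rewrite e01 addrK.
    by rewrite -[e0 in LHS](mulKf a0) ae0; field.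
  have EaV : E a^-1 := fldV fld Ea.
  have Eba : E (- (b / a)) by apply: (subalgN alg); apply: (subalgM alg).
  split=> [Ee1|z].
    have Ee0 : E e0 by rewrite e0E; apply: (subalgD alg) => //; apply: (subalgM alg).
    have [] := indep' e1 (- e0) Ee1 (subalgN alg Ee0); first by ring.
    move=> e10 /eqP; rewrite oppr_eq0 => /eqP e00.
    by move/eqP: e01; rewrite e10 e00 !mulr0 addr0 oner_eq0.
  have [u [v [Eu Ev ->]]] := span' z.
  exists (u * a^-1), (u * - (b / a) + v); split; last by rewrite {1}e0E; ring.
    exact: (subalgM alg).
  by apply: (subalgD alg) => //; apply: (subalgM alg).
have [z [zE gen]] : exists z, ~ E z /\ forall w, exists a b, [/\ E a, E b & w = a + b * z].
  have [a [b [Ea Eb e01]]] := span 1.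
  have [a0|a0] := eqVneq a 0; last by exists (e 1); apply: (main _ _ span indep a b).
  have b0 : b != 0.
    apply/eqP => b0; move/eqP: e01.
    by rewrite a0 b0 !mul0r addr0 oner_eq0.
  exists (e 0); apply: (main (e 1) _ _ _ b a) => //; last by rewrite addrC.
    by move=> w; have [u [v [Eu Ev ->]]] := span w; exists v, u; rewrite addrC.
  by move=> u v Eu Ev; rewrite addrC => /(indep v u Ev Eu)[-> ->].
have [p [q [Ep Eq z2]]] := gen (z ^+ 2).
(* Completing the square in z^2 = p + q z. *)
have Eh : E (q / 2%:R) by apply: (fld_div fld) => //; apply: subalg_nat alg _.
exists (z - q / 2%:R); split.
- have -> : (z - q / 2%:R) ^+ 2 = z ^+ 2 - q * z + (q / 2%:R) ^+ 2 by field.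
  rewrite z2 addrK; apply: (subalgD alg) => //; exact: (subalgX alg).
- by move=> H; apply: zE; rewrite -[z](subrK (q / 2%:R)); apply: (subalgD alg).
move=> w; have [a [b [Ea Eb ->]]] := gen w.
exists (a + b * (q / 2%:R)), b; split=> //; last by ring.
by apply: (subalgD alg) => //; apply: (subalgM alg).
Qed.

Lemma degree_over_quadratic (k F : fieldType) (c : {rmorphism k -> F})
    (E : F -> Prop) (s : F) : is_subfield c E -> ~ E s ->
  (forall z, exists a b, [/\ E a, E b & z = a + b * s]) -> degree_over E 2.
Proof.
move=> fld sE gen; exists (fun i => if i == 0 then 1 else s) => z.
have [a [b [Ea Eb ->]]] := gen z.
exists [ffun i : 'I_2 => if i == 0 then a else b]; split.
  split=> [i|]; first by rewrite ffunE; case: ifP.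
  by rewrite big_ord_recl big_ord1 !ffunE /= mulr1.
move=> f [Ef]; rewrite big_ord_recl big_ord1 /= mulr1 => e.
have [a0 b1] := quad_uniq fld sE Ea Eb (Ef _) (Ef _) e.
by apply/ffunP => i; rewrite ffunE; case: i => [[|[|//]] ilt] /=;
  rewrite ?a0 ?b1; congr (f _); apply: val_inj.
Qed.

Lemma algebraic_over_closed (k : closedFieldType) (F : fieldType)
    (c : {rmorphism k -> F}) z : algebraicOver c z -> exists a, z = c a.
Proof.
move=> [p p0]; have [r pE] := closed_field_poly_normal p.
rewrite rootE -evE pE -mul_polyC rmorphM evC mulf_eq0 fmorph_eq0 lead_coef_eq0.
rewrite (negPf p0) orFb; elim: r {pE} => [|a r IHr].
  by rewrite big_nil rmorph1 oner_eq0.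
rewrite big_cons rmorphM mulf_eq0 rmorphB evX evC subr_eq0.
by case/orP => [/eqP ->|/IHr //]; exists a.
Qed.

Lemma closed_point_subalg (k F : fieldType) (c : {rmorphism k -> F}) O :
  closed_point c O -> subalgebra c O.
Proof. by case. Qed.

Lemma closed_point_sqrt (k F : fieldType) (c : {rmorphism k -> F}) O v :
  closed_point c O -> O (v ^+ 2) -> O v.
Proof.
move=> pt Ov2; have alg := closed_point_subalg pt.
have [->|v0] := eqVneq v 0; first exact: (subalg0 alg).
case: (pt) => _ _ _ /(_ v v0)[//|OV] _.
have -> : v = v ^+ 2 * v^-1 by field.
exact: (subalgM alg).
Qed.

(** A valuation ring contains [x] or [x^-1], so here, unlike in [A], the affine chart and the chart
    with g = 0 suffice. The second coordinate follows because the ring is closed under square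
    roots. *)
Lemma regular_invariant_differential (k F : fieldType) (c : {rmorphism k -> F})
    L (x y : F) : distinct_points L -> size L = 4%N -> x != c 0 -> y != 0 ->
  y ^+ 2 = ev c x (quartic L) -> regular_differential c (fun d => d x / y).
Proof.
move=> dL sL xc y0 yE O pt; have alg := closed_point_subalg pt.
have x0 : x != 0 by move: xc; rewrite rmorph0.
case: (pt) => _ _ _ /(_ x x0)[Ox|OxV] _.
  have Oy : O y by apply: (closed_point_sqrt pt); rewrite yE; apply: (subalg_ev alg).
  have [P [Q PQ]] := invariant_differential (separable_quartic dL) yE y0.
  exists [:: (ev c x P * y, x); (ev c x Q, y)]; split.
    move=> ab; rewrite !inE => /orP[] /eqP -> /=; split=> //.
      by apply: (subalgM alg) => //; apply: (subalg_ev alg).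
    exact: (subalg_ev alg).
  by move=> d der; rewrite !big_cons big_nil addr0 /= PQ.
pose u := (x - c 0)^-1; pose v := y / (x - c 0) ^+ 2.
have Ou : O u by rewrite /u rmorph0 subr0.
have v0 : v != 0 by rewrite mulf_neq0 ?invr_neq0 ?expf_neq0 // subr_eq0.
have vE : v ^+ 2 = ev c u (quartic (translate_points 0 L)).
  rewrite ev_translate_points // -yE /v; field.
  by rewrite x0.
have Ov : O v by apply: (closed_point_sqrt pt); rewrite vE; apply: (subalg_ev alg).
have sep := separable_quartic (distinct_translate_points 0 dL).
have [P [Q PQ]] := invariant_differential sep vE v0.
exists [:: (- (ev c u P * v), u); (- ev c u Q, v)]; split.
  move=> ab; rewrite !inE => /orP[] /eqP -> /=; split=> //; apply: (subalgN alg).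
    by apply: (subalgM alg) => //; apply: (subalg_ev alg).
  exact: (subalg_ev alg).
move=> d der; rewrite !big_cons big_nil addr0 /=.
by rewrite (chart_differential der xc y0) -/u -/v PQ //; ring.
Qed.

(** * The Howe curve: a map of degree 2 forces l1 = m^2 l2 *)

Section HoweCurve.

Variables (k : closedFieldType) (F : fieldType) (c : {rmorphism k -> F}).
Hypothesis two : 2%:R != 0 :> k.
Variables (l1 l2 m : k).
Hypotheses (l1_0 : l1 != 0) (l1_1 : l1 != 1) (l2_0 : l2 != 0) (l2_1 : l2 != 1).
Hypotheses (m_0 : m != 0) (m_1 : m != 1).
Hypotheses (l1m : l1 != m) (ml2_1 : m * l2 != 1) (ml2_l1 : m * l2 != l1).
Variables (x y1 y2 : F).
Hypothesis xtr : ~ algebraicOver c x.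
Hypothesis y1E : y1 ^+ 2 = x * (x - 1) * (x - c l1).
Hypothesis y2E : y2 ^+ 2 = x * (x - c m) * (x - c (m * l2)).
Hypothesis gen : forall z, in_adjoin c (fun s => [\/ s = x, s = y1 | s = y2]) z.

(** The form [(0, 1)] is the branch point at infinity. The points 0 and infinity, common to [L1] and
    [L2], cancel in [L3]. *)
Let L1 : seq (k * k) := [:: (0, 1); (1, 0); (1, -1); (1, - l1)].
Let L2 : seq (k * k) := [:: (0, 1); (1, 0); (1, - m); (1, - (m * l2))].
Let L3 : seq (k * k) := [:: (1, -1); (1, - l1); (1, - m); (1, - (m * l2))].

Lemma two_F : 2%:R != 0 :> F.
Proof. by rewrite -(rmorph_nat c) fmorph_eq0. Qed.

Lemma distinct_L1 : distinct_points L1.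
Proof.
rewrite /distinct_points /= !(mul0r, mul1r, mulr1, mulr0, oner_neq0, orbT, andbT) /=.
by rewrite !(eq_sym 0) !oppr_eq0 oner_neq0 l1_0 eqr_opp l1_1.
Qed.

Lemma distinct_L2 : distinct_points L2.
Proof.
rewrite /distinct_points /= !(mul0r, mul1r, mulr1, mulr0, oner_neq0, orbT, andbT) /=.
rewrite !(eq_sym 0) !oppr_eq0 oner_neq0 eqr_opp m_0 mulf_neq0 //=.
by rewrite -[X in _ != X]mulr1 (inj_eq (mulfI m_0)) l2_1.
Qed.

Lemma distinct_L3 : distinct_points L3.
Proof.
rewrite /distinct_points /= !(mul0r, mul1r, mulr1, mulr0, oner_neq0, orbT, andbT) /=.
rewrite !eqr_opp l1_1 m_1 ml2_1 ml2_l1 (eq_sym m) l1m /=.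
by rewrite -[X in _ != X]mulr1 (inj_eq (mulfI m_0)) l2_1.
Qed.

Lemma x_neq g : x - c g != 0.
Proof. by rewrite subr_eq0; apply: transcendental_neq. Qed.

Lemma x_neq0 : x != 0. Proof. by have := x_neq 0; rewrite rmorph0 subr0. Qed.

Lemma x_neq1 : x - 1 != 0. Proof. by have := x_neq 1; rewrite rmorph1. Qed.

Lemma y1_neq0 : y1 != 0.
Proof. by rewrite -sqrf_eq0 y1E !mulf_neq0 ?x_neq0 ?x_neq1 ?x_neq. Qed.

Lemma y2_neq0 : y2 != 0.
Proof. by rewrite -sqrf_eq0 y2E !mulf_neq0 ?x_neq0 ?x_neq. Qed.

Lemma y1_quartic : y1 ^+ 2 = ev c x (quartic L1).
Proof.
rewrite ev_quartic !big_cons big_nil /= !rmorphN rmorph0 rmorph1 y1E; ring.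
Qed.

Lemma y2_quartic : y2 ^+ 2 = ev c x (quartic L2).
Proof.
rewrite ev_quartic !big_cons big_nil /= !rmorphN rmorph0 rmorph1 y2E; ring.
Qed.

Lemma y3_quartic : (y1 * y2 / x) ^+ 2 = ev c x (quartic L3).
Proof.
rewrite ev_quartic !big_cons big_nil /= !rmorphN rmorph1 expr_div_n exprMn y1E y2E.
by field; apply: x_neq0.
Qed.

(** If d x = 0, then 2 y dy = g'(x) dx gives d y1 = d y2 = 0. The kernel of [d] is a subfield
    containing the generators, so [d] vanishes on all of F. *)
Lemma derivation_x_neq0 d t : derivation c d -> d t != 0 -> d x != 0.
Proof.
move=> der; have [dD dM dC] := der; have [d0 d1 _ dB dX] := derivation_rules der.
apply: contraNneq => dx; have two' := two_F.
have dsqrt y L : y != 0 -> y ^+ 2 = ev c x (quartic L) -> d y = 0.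
  move=> y0 yE; have := dX y 1; rewrite yE (derivation_ev _ _ der) dx mulr0 expr1.
  by move/esym/eqP; rewrite !mulf_eq0 (negPf y0) (negPf two') => /eqP.
have fld0 : Defs.subfield_closed (fun z => d z = 0).
  split=> // a b da db; first by rewrite dB da db subrr.
  by rewrite dM (derivationV _ der) da db oppr0 mul0r !mulr0 addr0.
by apply/eqP/(gen t fld0 dC) => _ [] ->;
  [|exact: dsqrt y1_neq0 y1_quartic|exact: dsqrt y2_neq0 y2_quartic].
Qed.

Lemma quotient_degree2 t : map_to_P1_of_degree c 2 t -> l1 = m ^+ 2 * l2.
Proof.
move=> [tr deg]; have two' := two_F.
have fld := rat_in_subfield c t; have alg := fld_subalg fld.
have adjE : in_adjoin c (eq t) = rat_in c t.
  by apply/funext => z; apply/propext/in_adjoinP.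
rewrite adjE in deg.
have [s [s2E sE gens]] := quadratic_generator two' fld deg.
have [d der dt] := derivation_exists tr two' s2E sE gens.
have dx0 : d x != 0 by apply: (@derivation_x_neq0 _ t) => //; rewrite dt oner_neq0.
have x0 := x_neq0; have y10 := y1_neq0; have y20 := y2_neq0.
have y30 : y1 * y2 / x != 0 by rewrite !mulf_neq0 ?invr_neq0.
have odd y L : distinct_points L -> size L = 4%N -> y != 0 ->
    y ^+ 2 = ev c x (quartic L) ->
    exists b, [/\ rat_in c t b, b != 0 & d x = b * s * y].
  move=> dL sL y0 yE; have [a [b [Ea Eb xyE]]] := gens (d x / y).
  have a0 : a = 0.
    apply: (even_part_eq0 tr two' s2E sE gens der dt dL sL _ y0 yE Ea Eb xyE).
    by move=> g; apply: transcendental_neq.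
  have dxE : d x = b * s * y by rewrite -[b * s]add0r -a0 -xyE divfK.
  exists b; split=> //; apply: contraNneq dx0 => b0.
  by rewrite dxE b0 !mul0r.
have [b1 [Eb1 b10 dx1]] := odd _ _ distinct_L1 erefl y10 y1_quartic.
have [b2 [Eb2 b20 dx2]] := odd _ _ distinct_L2 erefl y20 y2_quartic.
have [b3 [Eb3 b30 dx3]] := odd _ _ distinct_L3 erefl y30 y3_quartic.
have s0 : s != 0 by apply: contra_notN sE => /eqP ->; apply: subalg0 alg.
(* [y1 / x] is y3 / y2, and b2 s y2 = b3 s y3 since both equal dx/dt. *)
have Y1 : y1 / x = b2 / b3.
  apply/eqP; rewrite eqr_div //; apply/eqP; apply: (mulfI (mulf_neq0 s0 (mulf_neq0 y20 (invr_neq0 x0)))).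
  transitivity (b3 * s * (y1 * y2 / x)); first by ring.
  by rewrite -dx3 dx2; field.
have Y2 : y2 / x = b1 / b3.
  apply/eqP; rewrite eqr_div //; apply/eqP; apply: (mulfI (mulf_neq0 s0 (mulf_neq0 y10 (invr_neq0 x0)))).
  transitivity (b3 * s * (y1 * y2 / x)); first by ring.
  by rewrite -dx3 dx1; field.
have EY1 : rat_in c t (y1 / x) by rewrite Y1; apply: (fld_div fld).
have EY2 : rat_in c t (y2 / x) by rewrite Y2; apply: (fld_div fld).
have Ec g : rat_in c t (c g) by case: fld.
have [/eqP|ne] := eqVneq (l1 - m ^+ 2 * l2) 0; first by rewrite subr_eq0 => /eqP.
(* Subtracting the two equations for (y_i / x)^2 leaves (l1 - m^2 l2) / x plus a constant; solving
   for 1/x puts x, y1, y2, and with them [s], in k(t). *)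
case: sE; pose e := c (l1 - m ^+ 2 * l2).
have e0 : e != 0 by rewrite fmorph_eq0.
have xV : x^-1 = ((y1 / x) ^+ 2 - (y2 / x) ^+ 2 - c (m * (1 + l2) - (1 + l1))) / e.
  have eE : e = c l1 - c m ^+ 2 * c l2 by rewrite /e rmorphB !rmorphM.
  have -> : c (m * (1 + l2) - (1 + l1)) = c m * (1 + c l2) - (1 + c l1).
    by rewrite rmorphB rmorphM !rmorphD rmorph1.
  rewrite !expr_div_n y1E y2E rmorphM eE; field.
  by rewrite x0 -eE e0.
have Ex : rat_in c t x.
  rewrite -[x]invrK; apply: (fldV fld); rewrite xV; apply: (fld_div fld); last exact: Ec.
  by do 2![apply: (subalgB alg) => //]; apply: (subalgX alg).
have [_ sub] := fld; apply: (gen s sub Ec) => _ [] -> //.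
  by rewrite -[y1](divfK x0); apply: (subalgM alg).
by rewrite -[y2](divfK x0); apply: (subalgM alg).
Qed.


(** * The case l1 = m^2 l2: a map of degree 2 from the conic *)

Section Conversely.

Hypothesis l1E : l1 = m ^+ 2 * l2.

(** The constant Y1^2 - Y2^2 of the conic, where Y_i = y_i / x. As [t] is the factor Y1 + Y2, the
    other factor is delta / t. Here delta = (m - 1)(1 - m l2). *)
Let delta := m * (1 + l2) - (1 + l1).
Let t := (y1 + y2) / x.

Lemma delta_neq0 : delta != 0.
Proof.
have -> : delta = (m - 1) * (1 - m * l2) by rewrite /delta l1E; ring.
by rewrite mulf_neq0 // subr_eq0 // eq_sym.
Qed.

Lemma conic_eq : t * ((y1 - y2) / x) = c delta.
Proof.
have -> : c delta = c m * (1 + c l2) - (1 + c m ^+ 2 * c l2).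
  by rewrite /delta l1E rmorphB rmorphM !rmorphD rmorphM rmorphXn rmorph1.
have -> : t * ((y1 - y2) / x) = (y1 ^+ 2 - y2 ^+ 2) / x ^+ 2.
  by rewrite /t; field; apply: x_neq0.
by rewrite y1E y2E l1E !rmorphM; field; apply: x_neq0.
Qed.

Lemma t_neq0 : t != 0.
Proof.
have dF : c delta != 0 by rewrite fmorph_eq0 delta_neq0.
by apply: contraNneq dF => t0; rewrite -conic_eq t0 mul0r.
Qed.

(** Y1^2 + 1 + l1, with Y1 = (t + delta / t) / 2. It will be the trace of [x] over k(t), the
    conjugate of [x] being l1 / x. *)
Let W := ((t ^+ 2 + c delta) / (2%:R * t)) ^+ 2 + 1 + c l1.

Lemma y1_over_x : y1 / x = (t ^+ 2 + c delta) / (2%:R * t).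
Proof.
have [t0 two'] := (t_neq0, two_F); rewrite -conic_eq.
have -> : (t ^+ 2 + t * ((y1 - y2) / x)) / (2%:R * t) = (t + (y1 - y2) / x) / 2%:R.
  by field; rewrite x_neq0 two' t0.
by rewrite /t; field; rewrite x_neq0 two'.
Qed.

Lemma x_quadratic : x + c l1 / x = W.
Proof. by rewrite /W -y1_over_x expr_div_n y1E; field; apply: x_neq0. Qed.

(** An algebraic [t] would be constant, making [W] constant and [x] a root of X^2 - W X + l1 over
    k. *)
Lemma t_transcendental : ~ algebraicOver c t.
Proof.
move=> /algebraic_over_closed[a tE]; apply: xtr.
pose w := ((a ^+ 2 + delta) / (2%:R * a)) ^+ 2 + 1 + l1.
have wE : W = c w.
  rewrite /W tE /w; move: (delta) => e.
  by rewrite !rmorphD rmorphXn fmorph_div rmorphD rmorphXn rmorphM rmorph_nat rmorph1.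
exists ('X^2 - w *: 'X + l1%:P).
  apply/eqP => /(congr1 (fun p : {poly k} => p`_2)).
  rewrite !(coefD, coefN, coefZ, coefXn, coefX, coefC, coef0) /= mulr0 subr0 addr0.
  by apply/eqP; rewrite oner_eq0.
rewrite rootE -evE !rmorphD rmorphN -mul_polyC rmorphXn rmorphM evX !evC -wE -x_quadratic.
by apply/eqP; field; apply: x_neq0.
Qed.

Let ttr := t_transcendental.

Lemma four_k : 4%:R != 0 :> k.
Proof. by rewrite (natrM _ 2 2) mulf_neq0. Qed.

Let B : {poly k} :=
  'X^4 + (2%:R * delta + 4%:R * (1 + l1))%:P * 'X^2 + (delta ^+ 2)%:P.

Lemma ev_B : ev c t B = 4%:R * t ^+ 2 * W.
Proof.
rewrite /B /W; move: (delta) (t_neq0) two_F => e t0 two'.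
rewrite !(rmorphD (ev c t)) evCM !evXn !evC rmorphXn.
have -> : c (2%:R * e + 4%:R * (1 + l1)) = 2%:R * c e + 4%:R * (1 + c l1).
  by rewrite rmorphD !(rmorphM c) !(rmorph_nat c) (rmorphD c 1) rmorph1.
by field; rewrite t0 two'.
Qed.

(** Multiplying z + l1/z = W by 4 t^2 z gives a polynomial identity in [t]. For n = 0 and n = 1 its
    coefficient of degree n + 4 forces a = 0. For n = 2, degrees 6, 4 and 2 give 4 a = 1, delta = -2
    (1 + l1) and delta^2 = 16 l1, whence l1 = 1. *)
Lemma not_monomial z a n : (n <= 2)%N -> z + c l1 / z = W -> z != 0 ->
  z != c a * t ^+ n.
Proof.
move=> n2 zW z0; apply/eqP => zE; have [t0 two'] := (t_neq0, two_F).
have a0 : a != 0 by apply: contraNneq z0 => a0; rewrite zE a0 rmorph0 mul0r.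
have four := four_k.
have polyE : (4%:R * a ^+ 2)%:P * 'X^(2 + (n + n)) + (4%:R * l1)%:P * 'X^2 =
    a%:P * 'X^(4 + n) + ((2%:R * delta + 4%:R * (1 + l1)) * a)%:P * 'X^(2 + n)
    + (delta ^+ 2 * a)%:P * 'X^n.
  have -> : a%:P * 'X^(4 + n) + ((2%:R * delta + 4%:R * (1 + l1)) * a)%:P * 'X^(2 + n)
      + (delta ^+ 2 * a)%:P * 'X^n = B * (a%:P * 'X^n).
    by rewrite /B !exprD !polyCM; ring.
  apply: (ev_inj ttr); rewrite (rmorphM _ B) ev_B -zW rmorphD !evCM.
  rewrite !evXn !rmorphM rmorph_nat -zE !exprD zE.
  have tn0 : t ^+ n != 0 by rewrite expf_neq0.
  have ca0 : c a != 0 by rewrite fmorph_eq0.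
  by field; rewrite tn0 ca0.
have coef i : (4%:R * a ^+ 2) * (i == 2 + (n + n))%:R + (4%:R * l1) * (i == 2)%:R =
    a * (i == 4 + n)%:R + (2%:R * delta + 4%:R * (1 + l1)) * a * (i == 2 + n)%:R
    + delta ^+ 2 * a * (i == n)%:R.
  by have := congr1 (fun p : {poly k} => p`_i) polyE; rewrite !(coefD, coefCM, coefXn).
case: n n2 {zE polyE} coef => [|[|[|//]]] _ coef.
- by have /eqP := coef 4%N; rewrite !mulr0 !mulr1 !addr0 eq_sym (negPf a0).
- by have /eqP := coef 5%N; rewrite !mulr0 !mulr1 !addr0 eq_sym (negPf a0).
have /eqP := coef 6%N; rewrite !mulr0 !mulr1 !addr0 => /eqP c6.
have /eqP := coef 4%N; rewrite !mulr0 !mulr1 !addr0 !add0r => /eqP c4.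
have /eqP := coef 2%N; rewrite !mulr0 !mulr1 !add0r => /eqP c2.
have a4 : 4%:R * a = 1 by apply: (mulIf a0); rewrite mul1r -[RHS]c6; ring.
have d2 : 2%:R * (delta + 2%:R * (1 + l1)) = 0.
  by apply: (mulIf a0); rewrite mul0r c4; ring.
have dE : delta = - (2%:R * (1 + l1)).
  apply/eqP; rewrite -addr_eq0; move/eqP: d2.
  by rewrite mulf_eq0 (negPf two).
have /eqP : 4%:R * (1 - l1) ^+ 2 = 0.
  transitivity (delta ^+ 2 * (4%:R * a) - 4%:R * (4%:R * l1)).
    by rewrite a4 dE; ring.
  by rewrite c2; ring.
by rewrite mulf_eq0 (negPf four) sqrf_eq0 subr_eq0 eq_sym (negPf l1_1).
Qed.

(** For x = p/q in lowest terms, 4 t^2 (p^2 + l1 q^2) = B p q shows that p and q divide t^2. Being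
    coprime, one of them is constant, so [x] or [l1 / x] is a monomial; both satisfy z + l1/z =
    W. *)
Lemma x_notin : ~ rat_in c t x.
Proof.
move=> /(rat_in_coprime ttr)[p [q [pq q0 xE]]].
have [x0 t0 four] := And3 x_neq0 t_neq0 four_k.
have eq0 : ev c t q != 0 by rewrite (ev_eq0 ttr).
have p0 : p != 0 by apply: contraNneq x0 => p0; rewrite xE p0 rmorph0 mul0r.
have ep0 : ev c t p != 0 by rewrite (ev_eq0 ttr).
have polyE : 4%:R%:P * 'X^2 * (p ^+ 2 + l1%:P * q ^+ 2) = B * p * q.
  apply: (ev_inj ttr); rewrite -(mulrA 4%:R%:P) -(mulrA B) evCM (rmorphM _ B) ev_B.
  rewrite (rmorphM _ 'X^2) evXn (rmorphD (ev c t)) evCM !(rmorphXn (ev c t)) (rmorphM _ p).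
  rewrite rmorph_nat -x_quadratic xE; field.
  by rewrite eq0 ep0.
have [i i2 pX] : exists2 i, (i <= 2)%N & p %= ('X - 0%:P) ^+ i.
  apply/dvdp_exp_XsubCP; rewrite subr0.
  have : p %| (4%:R * l1) *: 'X^2 * q ^+ 2.
    apply/dvdpP; exists (B * q - 4%:R%:P * 'X^2 * p).
    have -> : (B * q - 4%:R%:P * 'X^2 * p) * p =
      B * p * q - 4%:R%:P * 'X^2 * p ^+ 2 by ring.
    by rewrite -polyE -mul_polyC polyCM; ring.
  by rewrite Gauss_dvdpl ?coprimep_expr // dvdpZr // mulf_neq0.
have [j j2 qX] : exists2 j, (j <= 2)%N & q %= ('X - 0%:P) ^+ j.
  apply/dvdp_exp_XsubCP; rewrite subr0.
  have : q %| 4%:R *: 'X^2 * p ^+ 2.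
    apply/dvdpP; exists (B * p - 4%:R%:P * 'X^2 * l1%:P * q).
    have -> : (B * p - 4%:R%:P * 'X^2 * l1%:P * q) * q =
      B * p * q - 4%:R%:P * 'X^2 * (l1%:P * q ^+ 2) by ring.
    by rewrite -polyE -mul_polyC; ring.
  by rewrite Gauss_dvdpl ?coprimep_expr 1?coprimep_sym // dvdpZr.
have monomial r n : r != 0 -> r %= ('X - 0%:P) ^+ n ->
    exists2 a, a != 0 & ev c t r = c a * t ^+ n.
  move=> r0 /eqpP[[u v] /= /andP[u0 v0]]; rewrite subr0 => rE.
  exists (v / u); first by rewrite mulf_neq0 ?invr_neq0.
  have u0' : c u != 0 by rewrite fmorph_eq0.
  move/(congr1 (ev c t)): rE; rewrite -!mul_polyC !evCM evXn => rE.
  by rewrite fmorph_div mulrAC -rE mulrAC divff // mul1r.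
have [a a0 paE] := monomial p i p0 pX; have [b b0 qbE] := monomial q j q0 qX.
have [ca0 cb0 cl0] : [/\ c a != 0, c b != 0 & c l1 != 0] by rewrite !fmorph_eq0.
have tX n : t ^+ n != 0 by rewrite expf_neq0.
have [i0|i0] := posnP i; last have [j0|j0] := posnP j.
- have zE : c l1 / x = c (l1 * b / a) * t ^+ j.
    by rewrite xE paE qbE i0 fmorph_div rmorphM; field; rewrite ca0 cb0 tX.
  have zW : c l1 / x + c l1 / (c l1 / x) = W.
    by rewrite -x_quadratic; field; rewrite x0.
  have z0 : c l1 / x != 0 by rewrite mulf_neq0 ?invr_neq0.
  by have := @not_monomial _ (l1 * b / a) _ j2 zW z0; rewrite zE eqxx.
- have zE : x = c (a / b) * t ^+ i.
    by rewrite xE paE qbE j0 fmorph_div; field; rewrite cb0.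
  by have := @not_monomial _ (a / b) _ i2 x_quadratic x0; rewrite {1}zE eqxx.
have root0 (r : {poly k}) n : (0 < n)%N -> r %= ('X - 0%:P) ^+ n -> root r 0.
  move=> n0 /eqp_root ->; rewrite rootE horner_exp hornerXsubC subrr.
  by rewrite expf_eq0 n0 eqxx.
by have := coprimep_root pq (root0 p i i0 pX); rewrite (rootP (root0 q j j0 qX)) eqxx.
Qed.

Lemma x_generates z : exists a b, [/\ rat_in c t a, rat_in c t b & z = a + b * x].
Proof.
have fld := rat_in_subfield c t; have alg := fld_subalg fld.
have x0 := x_neq0; have t0 := t_neq0; have two' := two_F.
have Et : rat_in c t t := rat_in_gen c t.
have Ec g : rat_in c t (c g) by case: fld.
have E0 := subalg0 alg; have E2 := subalg_nat alg 2.
have EY1 : rat_in c t (y1 / x).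
  rewrite y1_over_x; apply: (fld_div fld); last exact: (subalgM alg).
  by apply: (subalgD alg) => //; apply: (subalgX alg).
have EY2 : rat_in c t (y2 / x).
  have -> : y2 / x = t - y1 / x by rewrite /t; field.
  exact: (subalgB alg).
have EW : rat_in c t W.
  rewrite /W -y1_over_x; do ?apply: (subalgD alg) => //; last exact: (subalg1 alg).
  exact: (subalgX alg).
have x2 : x ^+ 2 = W * x - c l1 by rewrite -x_quadratic; field.
pose P z := exists a b, [/\ rat_in c t a, rat_in c t b & z = a + b * x].
have PM u v : P u -> P v -> P (u * v).
  move=> [a [b [Ea Eb ->]]] [a' [b' [Ea' Eb' ->]]].
  exists (a * a' - b * b' * c l1), (a * b' + b * a' + b * b' * W); split.
  - by apply: (subalgB alg); do ?apply: (subalgM alg).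
  - by do ?apply: (subalgD alg); do ?apply: (subalgM alg).
  transitivity (a * a' + (a * b' + b * a') * x + b * b' * x ^+ 2); first by ring.
  by rewrite x2; ring.
have PE u : rat_in c t u -> P u by exists u, 0; rewrite mul0r addr0.
have PV u : P u -> P u^-1.
  have [->|u0] := eqVneq u 0; first by rewrite invr0 => _; apply: PE.
  move=> [a [b [Ea Eb uE]]].
  have Eab : rat_in c t (a + b * W).
    by apply: (subalgD alg) => //; apply: (subalgM alg).
  (* The norm of a + b x, whose conjugate is a + b (W - x); the conjugate can vanish only if [x] is
     in k(t). *)
  pose N := a ^+ 2 + a * b * W + b ^+ 2 * c l1.
  have NE : u * (a + b * W - b * x) = N.
    transitivity (a ^+ 2 + a * b * W + b ^+ 2 * (W * x - x ^+ 2)).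
      by rewrite uE; ring.
    by rewrite x2 /N; ring.
  have N0 : N != 0.
    rewrite -NE mulf_neq0 //; apply/eqP => /eqP; rewrite subr_eq0 => /eqP H.
    have [b0|b0] := eqVneq b 0.
      by move/eqP: u0; rewrite uE; move: H; rewrite b0 !mul0r !addr0.
    apply: x_notin; have -> : x = (a + b * W) / b by rewrite H mulrC mulKf.
    exact: (fld_div fld).
  have EN : rat_in c t N.
    by do ?apply: (subalgD alg); do ?apply: (subalgM alg); do ?apply: (subalgX alg).
  exists ((a + b * W) / N), (- b / N); split.
  - exact: (fld_div fld).
  - by apply: (fld_div fld) => //; apply: (subalgN alg).
  by apply: (mulfI u0); rewrite divff // -(divff N0) -{1}NE; ring.
have Pfld : Defs.subfield_closed P.
  split; first by apply: PE; apply: (subalg1 alg).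
    move=> _ _ [a [b [Ea Eb ->]]] [a' [b' [Ea' Eb' ->]]].
    by exists (a - a'), (b - b'); split; [exact: (subalgB alg)..|ring].
  by move=> u v Pu Pv; apply: PM => //; apply: PV.
have Px : P x by exists 0, 1; split=> //; [exact: (subalg1 alg) | rewrite add0r mul1r].
apply: (gen z Pfld) => [a|_ []->] //; first exact: PE.
  by rewrite -[y1](divfK x0); apply: PM => //; apply: PE.
by rewrite -[y2](divfK x0); apply: PM => //; apply: PE.
Qed.

(** dx/y1 and dx/y2 are independent: squaring a relation between y1 and y2 equates multiples of (x -
    m)(x - m l2) and (x - 1)(x - l1), and only the second vanishes at x = 1. *)
Lemma genus_at_least_2 : genus_at_least c 2.
Proof.
have [x0 y10 y20] := And3 x_neq0 y1_neq0 y2_neq0.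
have xc : x != c 0 by rewrite rmorph0.
exists (fun i d => if i == 0 then d x / y1 else d x / y2); split.
  move=> i; case: eqP => _.
    exact: regular_invariant_differential distinct_L1 erefl xc y10 y1_quartic.
  exact: regular_invariant_differential distinct_L2 erefl xc y20 y2_quartic.
move=> a aP; have two' := two_F.
have fld := rat_in_subfield c t.
have deg := degree_over_quadratic fld x_notin x_generates.
have [s [s2E sE gens]] := quadratic_generator two' fld deg.
have [d der dt] := derivation_exists ttr two' s2E sE gens.
have dx0 : d x != 0 by apply: (@derivation_x_neq0 _ t) => //; rewrite dt oner_neq0.
have := aP d der; rewrite big_ord_recl big_ord1 /= => aE.
set a1 := a (lift ord0 ord0) in aE.
have aE' : c (a ord0) * y2 = - (c a1 * y1).
  apply/eqP; rewrite -addr_eq0; apply/eqP/(mulfI dx0); rewrite mulr0 -(mulr0 (y1 * y2)) -[X in _ = _ * X]aE.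
  by field; rewrite y10 y20.
have polyE : (a ord0 ^+ 2)%:P * (('X - m%:P) * ('X - (m * l2)%:P)) =
    (a1 ^+ 2)%:P * (('X - 1%:P) * ('X - l1%:P)).
  apply: (ev_inj xtr); rewrite !evCM !(rmorphM (ev c x)) !rmorphB !evX !evC rmorph1.
  apply: (mulfI x0); transitivity ((c (a ord0) * y2) ^+ 2).
    by rewrite exprMn y2E rmorphXn; ring.
  by rewrite aE' sqrrN exprMn y1E rmorphXn; ring.
have a00 : a ord0 = 0.
  have /eqP := congr1 (fun p : {poly k} => p.[1]) polyE.
  rewrite !hornerM !hornerXsubC !hornerC subrr mul0r mulr0 !mulf_eq0 !subr_eq0.
  by rewrite (eq_sym 1 m) (eq_sym 1 (m * l2)) (negPf m_1) (negPf ml2_1) !orbF ?orbb => /eqP.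
have a10 : a1 = 0.
  move/esym/eqP: aE'; rewrite a00 rmorph0 mul0r oppr_eq0 mulf_eq0 (negPf y10) orbF.
  by rewrite fmorph_eq0 => /eqP.
by move=> i; case: (unliftP ord0 i) => [j ->|-> //]; rewrite ord1.
Qed.

Lemma hyperelliptic_if : hyperelliptic c.
Proof.
split; first exact: genus_at_least_2.
exists t; split; first exact: ttr.
have -> : in_adjoin c (eq t) = rat_in c t.
  by apply/funext => z; apply/propext/in_adjoinP.
exact: degree_over_quadratic (rat_in_subfield c t) x_notin x_generates.
Qed.

End Conversely.

Lemma hyperelliptic_iff : hyperelliptic c <-> l1 = m ^+ 2 * l2.
Proof.
split=> [[_ [t]]|]; [exact: quotient_degree2 | exact: hyperelliptic_if].
Qed.

End HoweCurve.

(** * Translating l1 = m^2 l2 into the vanishing of D *)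

Theorem proposition2p3 (K : fieldType) (p : nat)
  (K_char : p \in [pchar K]) (p_ge3 : (3 <= p)%N) (K_perfect : perfect_field K)
  (lambda1 lambda2 mu : K)
  (lambda1_neq0 : lambda1 != 0) (lambda1_neq1 : lambda1 != 1)
  (lambda2_neq0 : lambda2 != 0) (lambda2_neq1 : lambda2 != 1)
  (mu_neq0 : mu != 0) (mu_neq1 : mu != 1)
  (distinct : uniq [:: 1; lambda1; mu; mu * lambda2])
  (Kbar : closedFieldType) (iota : {rmorphism K -> Kbar})
  (Kbar_closure : algebraic_closure iota)
  (F : fieldType) (c : {rmorphism Kbar -> F}) :
  let E1 : {poly K} := 'X * ('X - 1%:P) * ('X - lambda1%:P) in
  let E2 : {poly K} := 'X * ('X - mu%:P) * ('X - (mu * lambda2)%:P) in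
  let lambda3 : K :=
    ((mu * lambda2 - 1) * (mu - lambda1)) /
    ((mu * lambda2 - lambda1) * (mu - 1)) in
  let D : K :=
    (lambda1 * lambda2 - lambda2 * lambda3 - lambda3 * lambda1 + 1) ^+ 2
    - 4%:R * lambda1 * lambda2 * (1 - lambda3) ^+ 2 in
  Howe_function_field c (map_poly iota E1) (map_poly iota E2) ->
  (hyperelliptic c <-> D = 0).
Proof.
move=> E1 E2 lambda3 D [x [y1 [y2 [xtr y1E y2E gen]]]].
have two : 2%:R != 0 :> K.
  rewrite -(dvdn_pcharf K_char); apply/negP => /(@dvdn_leq p 2 isT).
  by rewrite leqNgt p_ge3.
have two' : 2%:R != 0 :> Kbar by rewrite -(rmorph_nat iota) fmorph_eq0.
move: distinct; rewrite /= !inE !negb_or => /and4P[/and3P[l1n1 mn1 ml2n1]].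
move=> /andP[l1m l1ml2] mml2 _.
have ineq a b : a != b -> iota a != iota b by rewrite (inj_eq (fmorph_inj iota)).
have horner_map3 z a b : (map_poly c (map_poly iota ('X * ('X - a%:P) * ('X - b%:P)))).[z] =
    z * (z - c (iota a)) * (z - c (iota b)).
  by rewrite !rmorphM !rmorphB /= !map_polyX !map_polyC !hornerE.
have iff : hyperelliptic c <-> iota lambda1 = iota mu ^+ 2 * iota lambda2.
  apply: (@hyperelliptic_iff _ _ _ two' _ _ _ _ _ _ _ _ _ _ _ _ _ _ _ xtr _ _ gen).
  all: rewrite -?rmorphM ?fmorph_eq0 ?fmorph_eq1 //.
  - exact: ineq.
  - by rewrite eq_sym.
  - by apply: ineq; rewrite eq_sym.
  - by rewrite y1E horner_map3 !rmorph1.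
  by rewrite y2E horner_map3.
have den0 : (mu * lambda2 - lambda1) * (mu - 1) != 0.
  by rewrite mulf_neq0 // subr_eq0 // eq_sym.
(* With den the denominator of [lambda3], 1 - lambda3 = mu (1 - lambda1)(1 - lambda2) / den, and the
   first square in [D] has root (1 - lambda1)(1 - lambda2)(mu^2 lambda2 + lambda1) / den. What
   remains is (u + v)^2 - 4 u v = (u - v)^2 with u = mu^2 lambda2, v = lambda1. *)
have DE : D * ((mu * lambda2 - lambda1) * (mu - 1)) ^+ 2 =
    ((1 - lambda1) * (1 - lambda2) * (mu ^+ 2 * lambda2 - lambda1)) ^+ 2.
  rewrite /D /lambda3; field.
  by move: den0; rewrite mulf_eq0 negb_or andbC.
rewrite iff -rmorphXn -rmorphM; split=> [/fmorph_inj l1E|D0].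
  apply/eqP; have /eqP := DE; rewrite -l1E subrr mulr0 expr0n mulf_eq0 /=.
  by rewrite (negPf (expf_neq0 2 den0)) orbF.
congr (iota _); apply/esym/subr0_eq/eqP.
have /esym/eqP := DE; rewrite D0 mul0r sqrf_eq0 !mulf_eq0 !subr_eq0.
by rewrite !(eq_sym 1) (negPf lambda1_neq1) (negPf lambda2_neq1).
Qed.
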